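(* Let $\alpha>1/2$ and let $1\ge\gamma_1\ge\gamma_2\ge\cdots>0$ be product weights. Let $f\in\mathcal{H}_{d,\alpha,\boldsymbol{\gamma}}$ and $\delta\in(0,1)$ be given. Denote by $M=RN$ the total number of function evaluations used by the median lattice-based algorithm $A^{\mathrm{rand}}$, run with parameter $\tau=\eta/G_d$, where $G_d=2\sum_{j=1}^d\gamma_j^{1/(2\alpha)}$. Then for any $\eta\in(0,1)$, the following statements hold: 1. If $\sum_{j=1}^\infty\gamma_j^{1/(2\alpha)}<\infty$, then there exist a prime $N$ and an odd $R$, both independent of $d$ (with $R$ depending logarithmically on $N$), such that with probability at least $1-\delta$, $$\|f-A^{\mathrm{rand}}(f)\|_{L_2}^2\le\|f\|_{d,\alpha,\boldsymbol{\gamma}}^2\,\frac{C_N(G_\infty^{-1}\eta,\delta,\alpha)}{M^{2\alpha}}\,\exp\big(2\alpha(\eta^{-1}+1)G_\infty\big)\,N^{2\alpha\eta},$$ where $G_\infty=2\sum_{j=1}^\infty\gamma_j^{1/(2\alpha)}$. This means that the error bound for the $L_2$-approximation problem using $A^{\mathrm{rand}}$ does not depend on the dimension $d$. 2. If $\limsup_{d\to\infty}\big(\sum_{j=1}^d\gamma_j^{1/(2\alpha)}\big)/\log d<\infty$, then there exist a prime $N$ that depends at most polynomially on $d$, and an odd $R$ that depends at most logarithmically on $d$ and $N$, such that with probability at least $1-\delta$, $$\|f-A^{\mathrm{rand}}(f)\|_{L_2}^2\le\|f\|_{d,\alpha,\boldsymbol{\gamma}}^2\,\frac{C_N(G_d^{-1}\eta,\delta,\alpha)}{M^{2\alpha}}\,d^{\,2\alpha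 D(\eta^{-1}+1)}\,N^{2\alpha\eta},$$ for some constant $D>0$ independent of $d$ and $N$. This means that the error bound for the $L_2$-approximation problem using $A^{\mathrm{rand}}$ depends only polynomially on $d$.
   Context: **Korobov space.** For $d\in\mathbb{N}$ and $\boldsymbol{h}\in\mathbb{Z}^d$ put $r_{2\alpha,\boldsymbol{\gamma}}(\boldsymbol{h})=\prod_{j=1}^d\max\{|h_j|^{2\alpha}/\gamma_j,1\}$. The weighted Korobov space $\mathcal{H}_{d,\alpha,\boldsymbol{\gamma}}$ is the Hilbert space of functions $f$ on $[0,1]^d$, one-periodic in each variable and equal pointwise to their absolutely convergent Fourier series $f(\boldsymbol{x})=\sum_{\boldsymbol{h}\in\mathbb{Z}^d}\widehat f(\boldsymbol{h})\exp(2\pi \mathrm{i}\,\boldsymbol{h}\cdot\boldsymbol{x})$, where $\widehat f(\boldsymbol{h})=\int_{[0,1]^d}f(\boldsymbol{x})\exp(-2\pi \mathrm{i}\,\boldsymbol{h}\cdot\boldsymbol{x})\,d\boldsymbol{x}$, with finite norm $\|f\|_{d,\alpha,\boldsymbol{\gamma}}=\big(\sum_{\boldsymbol{h}\in\mathbb{Z}^d}|\widehat f(\boldsymbol{h})|^2r_{2\alpha,\boldsymbol{\gamma}}(\boldsymbol{h})\big)^{1/2}$. $\|\cdot\|_{L_2}$ is the norm of $L_2([0,1]^d)$. **Constant.** For $t>0$, $$C_N(t,\delta,\alpha)=\Big(\frac{N}{N-1}\Big)^{2\alpha}\Big(2\log\Big(1+\frac{N-1}{4e}\Big)+2\log(\delta^{-1})+1\Big)^{2\alpha}\Big(2t^{-1}+1+\frac{2N}{N-1}\log(N-1)\Big).$$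 **Parameters.** For $\tau>0$ and prime $N$, $$P_N(\tau,d,\boldsymbol{\gamma})=\prod_{j=1}^d\big(1+2\gamma_j^{1/(2\alpha)}(1+\tau\log N)\big),\qquad N_*=\frac{N-1}{\exp(\tau^{-1})P_N(\tau,d,\boldsymbol{\gamma})},$$ and $\mathcal{A}_d(N_* )=\{\boldsymbol{h}\in\mathbb{Z}^d: r_{2\alpha,\boldsymbol{\gamma}}(\boldsymbol{h})\le N_*^{2\alpha}\}$. **Median lattice-based algorithm.** Given $\tau$, a prime $N$ and an odd $R\in\mathbb{N}$, draw independently, for $r=1,\dots,R$, $\boldsymbol{z}_r$ uniformly from $\{1,\dots,N-1\}^d$ and $\boldsymbol{\Delta}_r$ uniformly from $[0,1)^d$. For $\boldsymbol{h}\in\mathcal{A}_d(N_* )$ set $$\widehat f_{N,\boldsymbol{z}_r,\boldsymbol{\Delta}_r}(\boldsymbol{h})=\frac1N\sum_{k=0}^{N-1}f\Big(\Big\{\frac{k\boldsymbol{z}_r}{N}+\boldsymbol{\Delta}_r\Big\}\Big)\exp\Big(-2\pi \mathrm{i}\,\boldsymbol{h}\cdot\Big(\frac{k\boldsymbol{z}_r}{N}+\boldsymbol{\Delta}_r\Big)\Big),$$ where $\{\cdot\}$ is the componentwise fractional part, and let $\widehat f_{\mathrm{med}}(\boldsymbol{h})$ be the median over $r\in\{1,\dots,R\}$ of these numbers, the median of complex numbers being the median of the real parts plus $\mathrm{i}$ times the median of the imaginary parts. The output is $(A^{\mathrm{rand}}(f))(\boldsymbol{x})=\sum_{\boldsymbol{h}\in\mathcal{A}_d(N_*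 )}\widehat f_{\mathrm{med}}(\boldsymbol{h})\exp(2\pi \mathrm{i}\,\boldsymbol{h}\cdot\boldsymbol{x})$. Probability is over the random choice of all $\boldsymbol{z}_r,\boldsymbol{\Delta}_r$. *)

(* Defs.v *)
From HB Require Import structures.
From mathcomp Require Import all_boot all_order all_algebra.
From mathcomp Require Import finmap.
From mathcomp Require Import complex.
From mathcomp Require Import all_classical all_reals all_analysis.

Set Implicit Arguments.
Unset Strict Implicit.
Unset Printing Implicit Defensive.

Import Order.TTheory GRing.Theory Num.Theory.

Local Open Scope classical_set_scope.
Local Open Scope ring_scope.

Section product_probability.
Context {d : measure_display} {T : measurableType d} {R : realType}.

Definition cons_pair (n : nat) (p : T * n.-tuple T) : n.+1.-tuple T :=
  [the n.+1.-tuple T of p.1 :: p.2].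

Lemma measurable_cons_pair (n : nat) : measurable_fun setT (@cons_pair n).
Proof. by apply: measurable_cons. Qed.

HB.instance Definition _ (n : nat) :=
  isMeasurableFun.Build _ _ _ _ (@cons_pair n) (@measurable_cons_pair n).

(* The n-fold product P (x) ... (x) P, i.e. the law of n independent draws
   from P. *)
Fixpoint power_prob (P : probability T R) (n : nat) :
    probability (n.-tuple T) R :=
  match n with
  | 0 => dirac [tuple]
  | m.+1 => distribution (P \x power_prob P m)%E (@cons_pair m)
  end.

End product_probability.

Section korobov.
Context {R : realType}.
Local Open Scope complex_scope.

(* Lebesgue measure of R^d restricted to [0,1]^d; it is also the uniform
   distribution on [0,1)^d. *)
Definition lebesgue_cube (d : nat) :
    probability (d.-tuple (measurableTypeR R)) R :=
  power_prob (uniform_prob (@ltr01 R)) d.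

Definition cintegral (d : nat) (g : d.-tuple R -> R[i]) : R[i] :=
  (\int[lebesgue_cube d]_x complex.Re (g x)) +i* (\int[lebesgue_cube d]_x complex.Im (g x)).

Definition L2norm (d : nat) (g : d.-tuple R -> R[i]) : \bar R :=
  Lnorm (lebesgue_cube d) 2%:E (fun x => (Normc.normc (g x))%:E).

Definition cexp2pi (t : R) : R[i] := cos (2 * pi * t) +i* sin (2 * pi * t).

Definition dotp (d : nat) (h : d.-tuple int) (x : d.-tuple R) : R :=
  \sum_(j < d) (tnth h j)%:~R * tnth x j.

Definition fourier (d : nat) (f : d.-tuple R -> R[i]) (h : d.-tuple int) :
    R[i] :=
  cintegral (fun x => f x * cexp2pi (- dotp h x)).

(* Unconditional summation: the finite partial sums converge to s along the
   directed set of finite index sets. *)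
Definition has_sum (I : choiceType) (a : I -> R[i]) (s : R[i]) : Prop :=
  forall e : R, 0 < e -> exists A0 : {fset I}, forall A : {fset I},
    (A0 `<=` A)%fset -> Normc.normc (\sum_(i <- A) a i - s) < e.

(* Here and below gamma j stands for the weight gamma_{j+1}. *)
Definition korobov_weight (alpha : R) (gamma : nat -> R) (d : nat)
    (h : d.-tuple int) : R :=
  \prod_(j < d)
    Num.max (`|(tnth h j)%:~R : R| `^ (2 * alpha) / gamma j) 1.

Definition korobov_norm2 (alpha : R) (gamma : nat -> R) (d : nat)
    (f : d.-tuple R -> R[i]) : \bar R :=
  (\esum_(h in [set: d.-tuple int])
    (Normc.normc (fourier f h) ^+ 2 * korobov_weight alpha gamma h)%:E)%E.

(* Real-valued; meaningful when korobov_norm2 is finite, i.e. on the Korobov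
   space. *)
Definition korobov_norm (alpha : R) (gamma : nat -> R) (d : nat)
    (f : d.-tuple R -> R[i]) : R :=
  Num.sqrt (fine (korobov_norm2 alpha gamma f)).

(* A one-periodic function on [0,1]^d is represented by its periodic extension
   to R^d. *)
Definition one_periodic (d : nat) (f : d.-tuple R -> R[i]) : Prop :=
  forall (x : d.-tuple R) (k : d.-tuple int),
    f [tuple tnth x j + (tnth k j)%:~R | j < d] = f x.

Definition korobov_space (alpha : R) (gamma : nat -> R) (d : nat)
    (f : d.-tuple R -> R[i]) : Prop :=
  [/\ one_periodic f,
      summable [set: d.-tuple int] (fun h => (Normc.normc (fourier f h))%:E),
      forall x, has_sum (fun h => fourier f h * cexp2pi (dotp h x)) (f x) &
      (korobov_norm2 alpha gamma f < +oo)%E].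

End korobov.

Section algorithm.
Context {R : realType}.
Local Open Scope complex_scope.

Definition median (s : seq R) : R := nth 0 (sort <=%O s) (size s)./2.

Definition cmedian (s : seq R[i]) : R[i] :=
  median [seq complex.Re z | z <- s] +i* median [seq complex.Im z | z <- s].

Definition G_sum (alpha : R) (gamma : nat -> R) (d : nat) : R :=
  2 * \sum_(j < d) gamma j `^ (2 * alpha)^-1.

Definition G_infty (alpha : R) (gamma : nat -> R) : R :=
  2 * fine (\sum_(j <oo) (gamma j `^ (2 * alpha)^-1)%:E)%E.

Definition P_N (alpha : R) (gamma : nat -> R) (d N : nat) (tau : R) : R :=
  \prod_(j < d) (1 + 2 * gamma j `^ (2 * alpha)^-1 * (1 + tau * ln N%:R)).

Definition N_star (alpha : R) (gamma : nat -> R) (d N : nat) (tau : R) : R :=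
  (N%:R - 1) / (expR tau^-1 * P_N alpha gamma d N tau).

Definition A_index (alpha : R) (gamma : nat -> R) (d : nat) (L : R) :
    set (d.-tuple int) :=
  [set h | korobov_weight alpha gamma h <= L `^ (2 * alpha)].

Definition lattice_node (d N : nat) (z : d.-tuple nat) (Delta : d.-tuple R)
    (k : nat) : d.-tuple R :=
  [tuple k%:R * (tnth z j)%:R / N%:R + tnth Delta j | j < d].

Definition frac_tuple (d : nat) (x : d.-tuple R) : d.-tuple R :=
  [tuple tnth x j - (Num.floor (tnth x j))%:~R | j < d].

Definition lattice_coef (d N : nat) (f : d.-tuple R -> R[i])
    (zD : d.-tuple nat * d.-tuple R) (h : d.-tuple int) : R[i] :=
  let x := lattice_node N zD.1 zD.2 in
  N%:R^-1 *
    \sum_(k < N) f (frac_tuple (x k)) * cexp2pi (- dotp h (x k)).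

Definition median_coef (d N m : nat) (f : d.-tuple R -> R[i])
    (w : m.-tuple (d.-tuple nat * d.-tuple R)) (h : d.-tuple int) : R[i] :=
  cmedian [seq lattice_coef N f zD h | zD <- w].

(* m is the number of repetitions (R in the usual notation) and w the list of
   the draws (z_r, Delta_r). The sum over the finite set of indices is a
   finitely supported one. *)
Definition A_rand (alpha : R) (gamma : nat -> R) (d N m : nat) (tau : R)
    (f : d.-tuple R -> R[i]) (w : m.-tuple (d.-tuple nat * d.-tuple R))
    (x : d.-tuple R) : R[i] :=
  \sum_(h \in A_index alpha gamma (N_star alpha gamma d N tau))
    median_coef N f w h * cexp2pi (dotp h x).

(* Uniform distribution on {1, ..., N-1}: the normalized sum of the Dirac
   masses at these points. The second argument of mnormalize is only used for
   N <= 1, where there are none. *)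
Definition uniform_pos (N : nat) : probability nat R :=
  mnormalize (msum (fun k => @dirac _ nat k.+1 R) N.-1) (dirac 1%N).

(* Joint law of the m independent draws (z_r, Delta_r). *)
Definition draws (d N m : nat) :
    probability (m.-tuple (d.-tuple nat * d.-tuple (measurableTypeR R))) R :=
  power_prob (power_prob (uniform_pos N) d \x lebesgue_cube d)%E m.

Definition C_N (alpha delta : R) (N : nat) (t : R) : R :=
  let n := N%:R : R in
  (n / (n - 1)) `^ (2 * alpha) *
  (2 * ln (1 + (n - 1) / (4 * expR 1)) + 2 * ln delta^-1 + 1) `^ (2 * alpha) *
  (2 * t^-1 + 1 + 2 * n / (n - 1) * ln (n - 1)).

(* With probability at least 1 - delta over the draws, the squared L_2 error
   of the algorithm run on f with parameter tau is at most B. *)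
Definition error_bound_whp (alpha : R) (gamma : nat -> R) (d N m : nat)
    (tau delta : R) (f : d.-tuple R -> R[i]) (B : R) : Prop :=
  ((1 - delta)%:E <= draws d N m
    [set w | L2norm (fun x => f x - A_rand alpha gamma N tau f w x)%R ^+ 2
             <= B%:E])%E.

End algorithm.

(* Main.v *)
(* For a draw (z, Delta) the computed coefficient at h is the sum of
   fhat(k) e((k - h) . Delta) over all k with (k - h) . z = 0 mod N. Let A be the index
   set of level N_star; it has at most N - 1 elements, pairwise distinct mod N. Let B be
   the index set of level N_star / 128, so that |B| <= (N - 1) / 128. Since
   P((k - h) . z = 0) <= 1 / (N - 1) when k and h are distinct mod N, with probability
   at least 1 - 1/128 no k in B other than h contributes. On this event Parseval's
   identity in Delta bounds the mean square error E_h at h by the mass of the k outside B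
   that are aliased to h, and by Markov's inequality the error exceeds 128 E_h with
   probability at most 1/128. Exchanging the sums over h and k, the E_h add up to at most
   2 sum_(k notin B) |fhat(k)|^2 <= 2 ||f||^2 (128 / N_star)^(2 alpha).
   A median over R = 2 n + 1 draws is bad only if n + 1 of them are, which has probability
   at most C(R, n + 1) 64^-(n + 1) <= 16^-(n + 1); a union bound over A allows R to be the
   largest odd number below the second factor of C_N. The squared error is then at most a
   constant, depending only on alpha, times ||f||^2 / N_star^(2 alpha), and that
   constant is absorbed by the factor ln(N - 1) of C_N as soon as N is large. In the second
   statement the prime N can thus even be chosen independently of d. *)

Require Import Defs.
From mathcomp Require Import all_boot all_order all_algebra.
From mathcomp Require Import finmap complex.
From mathcomp Require Import all_classical all_reals all_analysis.
From mathcomp Require Import measurable_realfun.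
From mathcomp Require Import zify ring lra.

Set Implicit Arguments.
Unset Strict Implicit.
Unset Printing Implicit Defensive.

Import Order.TTheory GRing.Theory Num.Theory.
Import numFieldNormedType.Exports.

Local Open Scope classical_set_scope.
Local Open Scope ring_scope.

(** * Monotonicity without measurability *)

(** The integral of a nonnegative function, measurable or not, is a supremum over the simple
    functions below it, and a larger function admits more of them. *)
Lemma ge0_le_integral_nomeas d (T : measurableType d) (R : realType)
    (mu : {measure set T -> \bar R}) (D : set T) (f g : T -> \bar R) :
  (forall x, D x -> 0 <= f x)%E -> (forall x, D x -> f x <= g x)%E ->
  (\int[mu]_(x in D) f x <= \int[mu]_(x in D) g x)%E.
Proof.
move=> f0 fg.
have g0 x : D x -> (0 <= g x)%E by move=> Dx; exact: le_trans (f0 _ Dx) (fg _ Dx).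
rewrite integral_mkcond [leRHS]integral_mkcond !ge0_integralTE; last 2 first.
- by move=> x; rewrite patchE; case: ifPn => // /[!inE]/g0.
- by move=> x; rewrite patchE; case: ifPn => // /[!inE]/f0.
apply: ereal_sup_le => _ [h /= hf <-]; exists h => //= x.
apply: le_trans (hf x) _; rewrite !patchE; case: ifPn => // /[!inE]; exact: fg.
Qed.

Lemma integral_le_cst d (T : measurableType d) (R : realType)
    (P : probability T R) (f : T -> \bar R) (c : R) :
  (forall x, 0 <= f x)%E -> (forall x, f x <= c%:E)%E ->
  (\int[P]_x f x <= c%:E)%E.
Proof.
move=> f0 fc; apply: le_trans.
  by apply: (@ge0_le_integral_nomeas _ _ _ _ _ _ (cst c%:E)) => x _; [exact: f0|exact: fc].
by rewrite integral_cst//= probability_setT mule1.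
Qed.

(* The event in [error_bound_whp] is never shown to be measurable: its probability
   is bounded from below through a measurable subset, which requires monotonicity
   on arbitrary sets. *)
Definition mono_meas T (R : realType) (mu : set T -> \bar R) :=
  forall A B, A `<=` B -> (mu A <= mu B)%E.

Section mono.
Variable R : realType.

(** The product measure integrates the [m2]-measure of the sections, so monotonicity of [m2] passes
    to the integrand pointwise. *)
Lemma mono_product d1 d2 (T1 : measurableType d1) (T2 : measurableType d2)
    (m1 : {measure set T1 -> \bar R}) (m2 : {measure set T2 -> \bar R}) :
  mono_meas m2 -> mono_meas (m1 \x m2)%E.
Proof.
move=> h A B AB; apply: ge0_le_integral_nomeas => x _ //=; apply: h.
exact: le_xsection.
Qed.

Lemma mono_dirac d (T : measurableType d) (x : T) : mono_meas (@dirac _ T x R).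
Proof.
move=> A B AB; rewrite /dirac lee_fin !indicE ler_nat.
by case: (boolP (x \in A)) => // /[!inE] /AB xB; rewrite mem_set.
Qed.

Lemma mono_power_prob d (T : measurableType d) (P : probability T R) n :
  mono_meas (power_prob P n).
Proof.
elim: n => [|n IH] /=; first exact: mono_dirac.
move=> A B AB; rewrite /distribution /pushforward; apply: (@mono_product _ _ _ _ P (power_prob P n) IH).
by move=> x /=; exact: AB.
Qed.

Lemma mono_draws d N m : mono_meas (draws d N m : probability _ R).
Proof. exact: mono_power_prob. Qed.

(** Conditioning on the first draw, for arbitrary sets [A]; this drives the inductions on the number
    of draws or coordinates. *)
Lemma power_probS d (T : measurableType d) (P : probability T R) n
    (A : set (n.+1.-tuple T)) :
  power_prob P n.+1 A
  = (\int[P]_x power_prob P n [set t | A (cons_pair (x, t))])%E.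
Proof.
rewrite /= /distribution /pushforward /product_measure1; apply: eq_integral => x _ /=.
by congr (power_prob P n _); apply/seteqP; split => t; rewrite /xsection/= inE.
Qed.

End mono.

(** * Probability of lying in the dual lattice *)

Definition dotz (d : nat) (l : d.-tuple int) (z : d.-tuple nat) : int :=
  \sum_(j < d) tnth l j * (tnth z j)%:Z.

Lemma dotz_cons d (h : int) (l : d.-tuple int) (xz : nat * d.-tuple nat) :
  dotz [tuple of h :: l] (cons_pair xz) = h * xz.1%:Z + dotz l xz.2.
Proof.
rewrite /dotz big_ord_recl /cons_pair !tnth0; congr (_ + _).
by apply: eq_bigr => j _; rewrite !tnthS.
Qed.

Section uniform_pos.
Variables (R : realType) (N : nat).
Hypothesis N_gt1 : (1 < N)%N.

Lemma uniform_posE (A : set nat) :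
  (uniform_pos N : probability _ R) A
  = ((\sum_(k < N.-1) \1_A k.+1) / (N.-1)%:R)%:E.
Proof.
change (mnormalize (msum (fun k => @dirac _ nat k.+1 R) N.-1) (@dirac _ nat 1%N R) A
  = ((\sum_(k < N.-1) \1_A k.+1) / (N.-1)%:R)%:E).
rewrite /mnormalize.
have msumE (B : set nat) : msum (fun k => @dirac _ nat k.+1 R) N.-1 B
    = (\sum_(k < N.-1) (\1_B k.+1 : R))%:E.
  by rewrite /msum -sumEFin.
have msumT : msum (fun k => @dirac _ nat k.+1 R) N.-1 setT = (N.-1)%:R%:E.
  rewrite msumE; congr (_%:E).
  under eq_bigr do rewrite indicT.
  by rewrite sumr_const card_ord.
cbv zeta; rewrite [X in X == 0%E]msumT [X in X == +oo%E]msumT [X in fine X]msumT.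
(* The total mass N - 1 is neither zero nor infinite, so the fallback measure of [mnormalize] does
   not occur. *)
rewrite eqe pnatr_eq0 ifF; last by case: N N_gt1 => [|[]].
by rewrite [X in (X * _)%E]msumE -EFinM.
Qed.

Lemma uniform_pos_le (A : set nat) :
  (forall x y, (0 < x < N)%N -> (0 < y < N)%N -> A x -> A y -> x = y) ->
  ((uniform_pos N : probability _ R) A <= (N.-1)%:R^-1%:E)%E.
Proof.
move=> hA; rewrite uniform_posE lee_fin ler_piMl ?invr_ge0 ?ler0n//.
have [[k0 Ak0]|nA] := pselect (exists k : 'I_N.-1, A k.+1).
- rewrite (bigD1 k0)//= big1 ?addr0 ?indicE ?mem_set//.
  move=> k kk0; rewrite indicE memNset// => Ak.
  suff : k.+1 = k0.+1 by case=> /val_inj kE; rewrite kE eqxx in kk0.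
  by apply: hA => //; rewrite /= -ltn_predRL ltn_ord.
- by rewrite big1// => k _; rewrite indicE memNset// => Ak; apply: nA; exists k.
Qed.

Lemma mono_le1 d (T : measurableType d) (P : probability T R) (A : set T) :
  mono_meas P -> (P A <= 1)%E.
Proof. by move=> h; rewrite -(@probability_setT _ _ _ P); exact: h. Qed.

(** Subtracting the two divisibilities gives N | h (y - x), hence N | y - x by Euclid's lemma, while
    |y - x| < N. *)
Lemma dvdz_prime_uniq (h a : int) (x y : nat) : prime N ->
  ~~ (N%:Z %| h)%Z -> (0 < x < N)%N -> (0 < y < N)%N ->
  (N%:Z %| h * x%:Z + a)%Z -> (N%:Z %| h * y%:Z + a)%Z -> x = y.
Proof.
move=> pN Nh.
wlog xy : x y / (x <= y)%N.
  move=> H hx hy ax ay; case/orP: (leq_total x y) => ?; first exact: H.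
  by apply/esym/H.
move=> /andP[x0 xN] /andP[y0 yN] ax ay.
have : (N%:Z %| h * (y - x)%N%:Z)%Z.
  rewrite -subzn// mulrBr.
  have -> : h * y%:Z - h * x%:Z = (h * y%:Z + a) - (h * x%:Z + a) by ring.
  exact: rpredB.
rewrite dvdzE abszM /= Euclid_dvdM// => /orP[].
  by move: Nh; rewrite dvdzE => /negbTE ->.
move=> /dvdn_leq H; have [yx|yx] := posnP (y - x)%N; first by lia.
by have := H yx; lia.
Qed.

(** The shift [a] absorbs the contribution of coordinates that are already fixed, which lets the
    induction on the dimension go through. *)
Definition dvdset d (l : d.-tuple int) (a : int) : set (d.-tuple nat) :=
  [set z | (N%:Z %| dotz l z + a)%Z].

(** Condition on the first coordinate of z. If the tail of [l] is nonzero mod N, the induction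
    hypothesis bounds every section. Otherwise the tail drops out mod N, the head is invertible, and
    at most one value of the first coordinate solves the congruence. *)
Lemma power_uniform_dvd d (l : d.-tuple int) (a : int) : prime N ->
  (exists j, ~~ (N%:Z %| tnth l j)%Z) ->
  (power_prob (uniform_pos N : probability _ R) d
     (dvdset l a) <= (N.-1)%:R^-1%:E)%E.
Proof.
move=> pN; elim: d l a => [l a [[]]//|d IH l a].
case: (tupleP l) => h {}l hl.
rewrite power_probS.
pose F (x : nat) := power_prob (uniform_pos N : probability _ R) d
  (dvdset l (h * x%:Z + a)).
rewrite (eq_integral F); last first.
  move=> x _; rewrite /F; congr (power_prob _ _ _); apply/seteqP; split => z;
   by rewrite /dvdset /= dotz_cons addrA [dotz l z + _]addrC.
have [hl'|hl'] := pselect (exists j, ~~ (N%:Z %| tnth l j)%Z).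
  apply: (@integral_le_cst _ _ _ (uniform_pos N) F (N.-1%:R^-1)) => x.
    exact: measure_ge0.
  exact: (IH _ _ hl').
have lN z : (N%:Z %| dotz l z)%Z.
  apply: rpred_sum => j _; apply: dvdz_mulr; apply/negPn/negP => H; apply: hl'; by exists j.
have hN : ~~ (N%:Z %| h)%Z.
  case: hl => j; case: (unliftP ord0 j) => [i ->|->]; rewrite ?tnthS ?tnth0//.
  by move=> H; exfalso; apply: hl'; exists i.
pose A := [set x : nat | (N%:Z %| h * x%:Z + a)%Z].
apply: (@le_trans _ _ (\int[uniform_pos N : probability _ R]_x (\1_A x)%:E)%E).
  apply: (@ge0_le_integral_nomeas _ _ _ (uniform_pos N)) => x _; first exact: measure_ge0.
  rewrite /F.
  rewrite indicE; case: (boolP (x \in A)) => [|xA].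
    by move=> _; apply: mono_le1; exact: mono_power_prob.
  rewrite (_ : dvdset l _ = set0) ?measure0//.
  apply/seteqP; split => // z; rewrite /dvdset /= rpredDl ?lN// => H.
  by move/negP: xA; apply; rewrite inE.
rewrite integral_indic// setIT.
by apply: uniform_pos_le => x y hx hy Ax Ay; exact: (dvdz_prime_uniq pN hN hx hy Ax Ay).
Qed.

End uniform_pos.

(** * Orthogonality of the characters on the cube *)

Section trig.
Variable R : realType.
Implicit Types s t : R.
Local Open Scope complex_scope.

Lemma cexp2piD s t : cexp2pi (s + t) = cexp2pi s * cexp2pi t.
Proof.
rewrite /cexp2pi mulrDr cosD sinD; congr (_ +i* _).
by rewrite addrC.
Qed.

Lemma cexp2pi0 : cexp2pi (0 : R) = 1.
Proof. by rewrite /cexp2pi mulr0 cos0 sin0. Qed.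

Lemma cexp2piN t : cexp2pi (- t) = (cexp2pi t)^*.
Proof. by rewrite /cexp2pi mulrN cosN sinN. Qed.

Lemma normc_cexp2pi t : Normc.normc (cexp2pi t) = 1.
Proof. by rewrite /= cos2Dsin2 sqrtr1. Qed.

Lemma cexp2pi1 : cexp2pi (1 : R) = 1.
Proof. by rewrite /cexp2pi mulr1 mulr_natl cos2pi sin2pi. Qed.

Lemma cexp2pi_nat (n : nat) : cexp2pi (n%:R : R) = 1.
Proof.
elim: n => [|n IH]; first exact: cexp2pi0.
by rewrite -natr1 cexp2piD IH mul1r cexp2pi1.
Qed.

Lemma cexp2pi_int (n : int) : cexp2pi (n%:~R : R) = 1.
Proof.
case: n => n; first exact: cexp2pi_nat.
by rewrite NegzE mulrNz cexp2piN cexp2pi_nat conjc1.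
Qed.

(** The real part is 1 - 2 sin^2(pi t), and the sine is positive on (0, pi). *)
Lemma cexp2pi_neq1 t : 0 < t < 1 -> cexp2pi t != 1.
Proof.
move=> /andP[t0 t1]; rewrite /cexp2pi eq_complex /= negb_and.
rewrite mulrAC -mulrA mulr_natl cos_mulr2n.
have : 0 < sin (t * pi).
  by apply: sin_gt0_pi; rewrite mulr_gt0 ?pi_gt0//= gtr_pMl ?pi_gt0.
move=> s0; apply/orP; left; apply/negP => /eqP.
rewrite mulr2n cos2sin2 => H.
have : sin (t * pi) ^+ 2 = 0 by lra.
by move/eqP; rewrite sqrf_eq0 gt_eqF.
Qed.

Lemma integral_uniform_1Dcos (h : int) t :
  (\int[uniform_prob (@ltr01 R)]_x (1 + cos (2 * pi * (h%:~R * x) + t))%:E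
   = (1 + (if h == 0 then cos t else 0))%:E)%E.
Proof.
have cc : continuous (fun x : R => 1 + cos (2 * pi * (h%:~R * x) + t)).
  move=> x; apply: cvgD; first exact: cvg_cst.
  apply: continuous_comp; last exact: continuous_cos.
  apply: cvgD; last exact: cvg_cst.
  by apply: cvgM; [exact: cvg_cst|apply: cvgM; [exact: cvg_cst|exact: cvg_id]].
rewrite integral_uniform; last 2 first.
- by apply/measurable_EFinP; exact: continuous_measurable_fun.
- by move=> x; rewrite lee_fin -lerBlDl sub0r cos_geN1.
rewrite subr0 invr1 mul1e.
have [->|h0] := eqVneq h 0.
  under eq_integral do rewrite mul0r mulr0 add0r.
  rewrite integral_cst//=.
  rewrite lebesgue_measure_itv/= lte_fin ltr01 -EFinB subr0.
  by rewrite mule1.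
have c0 : 2 * pi * h%:~R != 0 :> R.
  by rewrite mulf_neq0 ?intr_eq0// mulf_neq0 ?pnatr_eq0// gt_eqF// pi_gt0.
(* An antiderivative of the integrand; its oscillating part takes equal values at 0 and 1 because
   [h] is an integer. *)
pose F (x : R) := x + (2 * pi * h%:~R)^-1 * sin (2 * pi * (h%:~R * x) + t).
have dF (x : R) : is_derive x 1 F (1 + cos (2 * pi * (h%:~R * x) + t)).
  apply: is_derive_eq.
  rewrite /GRing.scale /= addr0 mulr1; congr (1 + _).
  by rewrite mulrCA mulVf ?mulr1.
have := @continuous_FTC2 R (fun x => 1 + cos (2 * pi * (h%:~R * x) + t)) F 0 1 ltr01.
move=> ->//.
- rewrite -EFinB /F !mulr0 add0r mulr1.
  have -> : sin (2 * pi * h%:~R + t) = sin t.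
    have := cexp2pi_int h; rewrite /cexp2pi => -[cE sE].
    by rewrite sinD cE sE mul0r mul1r add0r.
  by rewrite add0r addr0 addrK.
- exact: continuous_subspaceT.
- have derF x : derivable F x 1 by have [] := dF x.
  have contF x : {for x, continuous F}.
    by apply: differentiable_continuous; apply/derivable1_diffP; exact: derF.
  split => //=.
  + by apply: cvg_at_right_filter; exact: contF.
  + by apply: cvg_at_left_filter; exact: contF.
- by move=> x _; rewrite derive1E; have [_ ->] := dF x.
Qed.

End trig.

Lemma ge0_integral_power_probS d (T : measurableType d) (R : realType)
    (P : probability T R) n (f : n.+1.-tuple T -> \bar R) :
  measurable_fun [set: n.+1.-tuple T] f -> (forall x, 0 <= f x)%E ->
  (\int[power_prob P n.+1]_x f x
   = \int[P]_x \int[power_prob P n]_t f (cons_pair (x, t)))%E.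
Proof.
move=> mf f0.
have := @ge0_integral_distribution _ _ _ _ R (P \x power_prob P n)%E (@cons_pair _ T n) f mf f0.
move=> /= ->.
rewrite (@fubini_tonelli1 _ _ _ _ _ P (power_prob P n) (f \o @cons_pair _ T n)) //=.
by apply: measurableT_comp => //; exact: measurable_cons_pair.
Qed.

Section orthogonality.
Variable R : realType.
Local Open Scope complex_scope.

Lemma dotp_cons d (h : int) (l : d.-tuple int) (x : R * d.-tuple R) :
  dotp [tuple of h :: l] (cons_pair (T := measurableTypeR R) x) = h%:~R * x.1 + dotp l x.2.
Proof.
rewrite /dotp big_ord_recl /cons_pair !tnth0; congr (_ + _).
by apply: eq_bigr => j _; rewrite !tnthS.
Qed.

Lemma measurable_dotp d (l : d.-tuple int) :
  measurable_fun [set: d.-tuple (measurableTypeR R)] (dotp l : d.-tuple R -> R).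
Proof.
apply: measurable_sum => j; apply: measurable_funM => //.
exact: measurable_tnth.
Qed.

Lemma measurable_cos : measurable_fun [set: R] (@cos R).
Proof. by apply: continuous_measurable_fun; exact: continuous_cos. Qed.

Lemma measurable_cos_dotp d (l : d.-tuple int) (t : R) :
  measurable_fun [set: d.-tuple (measurableTypeR R)]
    (fun x : d.-tuple R => cos (2 * pi * dotp l x + t)).
Proof.
apply: measurableT_comp; first exact: measurable_cos.
apply: measurable_funD; last exact: measurable_cst.
exact: measurable_funM (measurable_cst _) (measurable_dotp l).
Qed.

Definition tuple_eq0 d (l : d.-tuple int) := [forall j, tnth l j == 0].

Lemma tuple_eq0_cons d (h : int) (l : d.-tuple int) :
  tuple_eq0 [tuple of h :: l] = (h == 0) && tuple_eq0 l.
Proof.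
apply/forallP/andP => [H|[h0 /forallP H] j].
  split; first by have := H ord0; rewrite tnth0.
  by apply/forallP => j; have := H (lift ord0 j); rewrite tnthS.
by case: (unliftP ord0 j) => [i ->|->]; rewrite ?tnthS ?tnth0.
Qed.

(* The constant 1 makes the integrand nonnegative, so that the induction on the
   dimension only needs Tonelli's theorem. *)
Lemma integral_cube_1Dcos d (l : d.-tuple int) (t : R) :
  (\int[lebesgue_cube d]_x (1 + cos (2 * pi * dotp l x + t))%:E
   = (1 + (if tuple_eq0 l then cos t else 0))%:E)%E.
Proof.
have m1c n (l' : n.-tuple int) t' : measurable_fun [set: n.-tuple (measurableTypeR R)]
    (fun x : n.-tuple R => (1 + cos (2 * pi * dotp l' x + t'))%:E).
  by apply/measurable_EFinP; apply: measurable_funD => //; exact: measurable_cos_dotp.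
have ge0 (x : R) : (0 <= (1 + cos x)%:E)%E.
  by rewrite lee_fin -lerBlDl sub0r cos_geN1.
elim: d l t => [|d IH] l t.
  rewrite /lebesgue_cube /= integral_dirac//=; last exact: m1c.
  rewrite diracT mul1e /dotp big_ord0 mulr0 add0r ifT//.
  by apply/forallP => -[].
case: (tupleP l) => h {}l.
rewrite /lebesgue_cube ge0_integral_power_probS; last 2 first.
- exact: (m1c d.+1 [tuple of h :: l] t).
- by move=> x; exact: ge0.
rewrite tuple_eq0_cons.
under eq_integral => x _.
  (* The first coordinate is moved into the phase, where the induction hypothesis can treat it as a
     constant. *)
  under eq_integral => y _.
    rewrite dotp_cons/= mulrDr (addrC (2 * pi * (h%:~R * x))) -addrA.
    over.
  rewrite -/(lebesgue_cube d) IH.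
  over.
case: (tuple_eq0 l); last first.
  rewrite andbF.
  by rewrite integral_cst//= [X in (_ * X)%E]probability_setT mule1.
by rewrite andbT; exact: integral_uniform_1Dcos.
Qed.

End orthogonality.

(** * Parseval's identity for trigonometric polynomials on the cube *)

Section parseval.
Variable R : realType.
Local Open Scope complex_scope.
Local Notation normc := Normc.normc.
Implicit Types (z : R[i]).

Lemma normc_sqr z : normc z ^+ 2 = complex.Re z ^+ 2 + complex.Im z ^+ 2.
Proof. by case: z => a b /=; rewrite sqr_sqrtr// addr_ge0 ?sqr_ge0. Qed.

Lemma normc_sqr_Re z : normc z ^+ 2 = complex.Re (z * z^*).
Proof.
rewrite normc_sqr; case: z => a b /=; ring.
Qed.

Lemma ReD z1 z2 : complex.Re (z1 + z2) = complex.Re z1 + complex.Re z2.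
Proof. by case: z1 z2 => [? ?] [? ?]. Qed.

Lemma Re_sum I (s : seq I) (F : I -> R[i]) :
  complex.Re (\sum_(i <- s) F i) = \sum_(i <- s) complex.Re (F i).
Proof. exact: (big_morph _ ReD). Qed.

Lemma normc_ge0 z : 0 <= normc z.
Proof. by case: z => a b /=; exact: sqrtr_ge0. Qed.

Lemma normc_sum I (s : seq I) (F : I -> R[i]) :
  normc (\sum_(i <- s) F i) <= \sum_(i <- s) normc (F i).
Proof.
elim/big_rec2: _ => [|i y1 y2 _ h]; first by rewrite Normc.normc0.
by apply: le_trans (le_normcD _ _) _; rewrite lerD2l.
Qed.

Definition subt d (k l : d.-tuple int) : d.-tuple int :=
  [tuple tnth k j - tnth l j | j < d].

Lemma dotp_subt d (k l : d.-tuple int) (x : d.-tuple R) :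
  dotp (subt k l) x = dotp k x - dotp l x.
Proof.
rewrite /dotp -sumrB; apply: eq_bigr => j _.
by rewrite tnth_mktuple intrB mulrBl.
Qed.

Lemma tuple_eq0_subt d (k l : d.-tuple int) : tuple_eq0 (subt k l) = (k == l).
Proof.
apply/forallP/eqP => [H|-> j]; last by rewrite tnth_mktuple subrr.
by apply: eq_from_tnth => j; have := H j; rewrite tnth_mktuple subr_eq0 => /eqP.
Qed.

Lemma integrable_cos_dotp d (l : d.-tuple int) (t : R) :
  (lebesgue_cube d).-integrable setT
    (fun x => (cos (2 * pi * dotp l x + t))%:E).
Proof.
apply: (@measurable_bounded_integrable _ _ _ (lebesgue_cube d) (fun x => cos (2 * pi * dotp l x + t))) => //.
- by rewrite [X in (X < _)%E]probability_setT ltry.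
- exact: measurable_cos_dotp.
- exists 1; split => // M M1 x _ /=; apply: le_trans (ltW M1); exact: cos_max.
Qed.

Lemma integral_cube_cos d (l : d.-tuple int) (t : R) :
  (\int[lebesgue_cube d]_x (cos (2 * pi * dotp l x + t))%:E
   = (if tuple_eq0 l then cos t else 0)%:E)%E.
Proof.
have := integral_cube_1Dcos l t.
under eq_integral do rewrite EFinD.
rewrite (@integralD _ _ _ (lebesgue_cube d) setT measurableT (cst 1%E) (fun x => (cos (2 * pi * dotp l x + t))%:E)); last 2 first.
- exact: (@finite_measure_integrable_cst _ _ _ (lebesgue_cube d) setT 1 measurableT).
- exact: integrable_cos_dotp.
rewrite /= integral_cst//= [X in (_ * X)%E]probability_setT mule1 EFinD.
rewrite addeC (addeC 1%:E) => /(congr1 (fun u => u - 1%:E)%E).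
by rewrite !addeK.
Qed.

(** The phase pi / 2 turns the sine into a cosine, so the integral of a phase-shifted cosine covers
    both terms. *)
Lemma Re_cexp2pi (c : R[i]) (t : R) :
  complex.Re (c * cexp2pi t)
  = complex.Re c * cos (2 * pi * t + 0) + complex.Im c * cos (2 * pi * t + pi / 2).
Proof. by rewrite addr0 cosDpihalf; case: c => a b /=; rewrite mulrN. Qed.

Lemma integrable_Re_cexp2pi d (c : R[i]) (l : d.-tuple int) :
  (lebesgue_cube d).-integrable setT
    (fun x => (complex.Re (c * cexp2pi (dotp l x)))%:E).
Proof.
under eq_fun do rewrite Re_cexp2pi EFinD !EFinM.
by apply: integrableD; [exact: measurableT| |]; (apply: integrableZl; [exact: measurableT|exact: integrable_cos_dotp]).
Qed.

Lemma integral_Re_cexp2pi d (c : R[i]) (l : d.-tuple int) :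
  (\int[lebesgue_cube d]_x (complex.Re (c * cexp2pi (dotp l x)))%:E
   = (if tuple_eq0 l then complex.Re c else 0)%:E)%E.
Proof.
under eq_integral do rewrite Re_cexp2pi EFinD.
have i1 (c' t : R) : (lebesgue_cube d).-integrable setT
    (fun x => (c' * cos (2 * pi * dotp l x + t))%:E).
  under eq_fun do rewrite EFinM.
  by apply: integrableZl; [exact: measurableT|exact: integrable_cos_dotp].
rewrite integralD//; [|exact: i1..].
under eq_integral do rewrite EFinM.
under [X in (_ + X)%E]eq_integral do rewrite EFinM.
rewrite !integralZl//; [|exact: integrable_cos_dotp..].
rewrite !integral_cube_cos cos0 cos_pihalf; case: ifP => _; rewrite -!EFinM -EFinD.
  by rewrite mulr1 mulr0 addr0.
by rewrite !mulr0 addr0.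
Qed.

Definition trigpoly d (K : seq (d.-tuple int)) (a : d.-tuple int -> R[i]) (x : d.-tuple R) : R[i] :=
  \sum_(k <- K) a k * cexp2pi (dotp k x).

Lemma normc_trigpoly d (K : seq (d.-tuple int)) (a : d.-tuple int -> R[i]) (x : d.-tuple R) :
  normc (trigpoly K a x) ^+ 2 =
  \sum_(k <- K) \sum_(l <- K) complex.Re (a k * (a l)^* * cexp2pi (dotp (subt k l) x)).
Proof.
rewrite normc_sqr_Re /trigpoly rmorph_sum mulr_suml Re_sum.
apply: eq_bigr => k _; rewrite mulr_sumr Re_sum; apply: eq_bigr => l _.
by rewrite dotp_subt cexp2piD cexp2piN rmorphM mulrACA.
Qed.

Lemma measurable_normc_trigpoly d (K : seq (d.-tuple int)) (a : d.-tuple int -> R[i]) :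
  measurable_fun [set: d.-tuple (measurableTypeR R)]
    (fun x : d.-tuple R => normc (trigpoly K a x) ^+ 2).
Proof.
under eq_fun do rewrite normc_trigpoly.
apply: measurable_sum => k; apply: measurable_sum => l.
by apply/measurable_EFinP; case/integrableP: (integrable_Re_cexp2pi (a k * (a l)^*) (subt k l)).
Qed.

(** The expanded square involves the characters of frequencies k - l; as [K] has no repetitions,
    only the diagonal survives integration. *)
Lemma parseval d (K : seq (d.-tuple int)) (a : d.-tuple int -> R[i]) : uniq K ->
  (\int[lebesgue_cube d]_x (normc (trigpoly K a x) ^+ 2)%:E
   = (\sum_(k <- K) normc (a k) ^+ 2)%:E)%E.
Proof.
move=> uK.
under eq_integral.
  move=> x _; rewrite normc_trigpoly -sumEFin.
  under eq_bigr do rewrite -sumEFin.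
  over.
have iT k l : (lebesgue_cube d).-integrable setT
    (fun x => (complex.Re (a k * (a l)^* * cexp2pi (dotp (subt k l) x)))%:E).
  exact: integrable_Re_cexp2pi.
rewrite integral_sum//; last by move=> k; exact: integrable_sum.
rewrite -sumEFin; apply: eq_big_seq => k kK.
rewrite integral_sum//.
rewrite (bigD1_seq k)//= integral_Re_cexp2pi tuple_eq0_subt eqxx -normc_sqr_Re.
rewrite big1 ?adde0// => l lk.
by rewrite integral_Re_cexp2pi tuple_eq0_subt eq_sym (negbTE lk).
Qed.

End parseval.

(** * Uniform approximation and the L2 error *)

Lemma big_fsetU_diff (V : nmodType) (I : choiceType) (K A : {fset I}) (F : I -> V) :
  (K `<=` A)%fset ->
  \sum_(i <- A) F i = \sum_(i <- K) F i + \sum_(i <- (A `\` K)%fset) F i.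
Proof.
move=> /fsubsetP KA; rewrite (big_fsetID _ (fun i => i \in K)) /=; congr (_ + _).
  apply: eq_fbigl => i; rewrite !inE /=; case: (boolP (i \in K)) => [/KA ->|];
  by rewrite ?andbF.
by apply: eq_fbigl => i; rewrite !inE /= andbC.
Qed.

Section sums.
Variables (R : realType) (I : choiceType) (u : I -> R).
Hypothesis u0 : forall i, 0 <= u i.

Lemma fset_sum_le_esum (A : {fset I}) :
  ((\sum_(i <- A) u i)%:E <= \esum_(i in [set: I]) (u i)%:E)%E.
Proof.
apply: esum_ge; exists [set` A]; first by split.
rewrite fsbig_finite//= set_fsetK sumEFin//.
Qed.

Hypothesis su : (\esum_(i in [set: I]) (u i)%:E < +oo)%E.

Let S := fine (\esum_(i in [set: I]) (u i)%:E)%E.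

Lemma fine_esumK : (\esum_(i in [set: I]) (u i)%:E)%E = S%:E.
Proof. by rewrite fineK// ge0_fin_numE// esum_ge0// => i _; rewrite lee_fin. Qed.

Lemma fset_sum_le (A : {fset I}) : \sum_(i <- A) u i <= S.
Proof. by rewrite -lee_fin -fine_esumK; exact: fset_sum_le_esum. Qed.

(** Take a finite set [K0] whose sum is within e of the total: a finite set disjoint from it can add
    at most e. *)
Lemma fset_sum_tail (e : R) : 0 < e -> exists K0 : {fset I},
  forall A K : {fset I}, (K0 `<=` K)%fset -> \sum_(i <- (A `\` K)%fset) u i <= e.
Proof.
move=> e0.
have : ((S - e)%:E < \esum_(i in [set: I]) (u i)%:E)%E.
  by rewrite fine_esumK lte_fin gtrBl.
move=> /ereal_sup_gt[_ [K0 [fK0 _] <-]].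
rewrite fsbig_finite//= sumEFin lte_fin => h.
exists (fset_set K0) => A K K0K.
have dK0 : [disjoint fset_set K0 & A `\` K]%fset.
  apply/fdisjointP => i /(fsubsetP K0K) iK; by rewrite !inE iK.
have := fset_sum_le (fset_set K0 `|` (A `\` K))%fset.
rewrite (@big_fsetU_diff _ _ (fset_set K0)) ?fsubsetUl//.
rewrite fsetDUl fsetDv fset0U.
rewrite (_ : ((A `\` K) `\` fset_set K0)%fset = (A `\` K)%fset); last first.
  by apply/fsetDidPl; rewrite fdisjoint_sym.
by move=> H; move: h; rewrite ltrBlDr => h; have := le_lt_trans H h; rewrite ltrD2l => /ltW.
Qed.

End sums.

Section approximation.
Variables (R : realType) (alpha : R) (gamma : nat -> R) (d : nat).
Variable f : d.-tuple R -> R[i].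
Hypothesis fK : korobov_space alpha gamma f.
Local Open Scope complex_scope.
Local Notation normc := Normc.normc.
Local Notation fhat := (fourier f).
Local Notation S := (fine (\esum_(k in [set: d.-tuple int]) (normc (fhat k))%:E)%E).

Let abs_summable : (\esum_(k in [set: d.-tuple int]) (normc (fhat k))%:E < +oo)%E.
Proof.
case: fK => _ + _ _; rewrite /summable; apply: le_lt_trans.
by apply: le_esum => k _; rewrite /= ger0_norm// normc_ge0.
Qed.

Lemma sum_normc_fhat (A : {fset d.-tuple int}) : \sum_(k <- A) normc (fhat k) <= S.
Proof. by apply: fset_sum_le => // k; exact: normc_ge0. Qed.

(** The Fourier series is only given to converge pointwise; absolute summability of the coefficients
    makes the convergence uniform in x. *)
Lemma korobov_approx (e : R) : 0 < e -> exists K0 : {fset d.-tuple int},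
  forall K : {fset d.-tuple int}, (K0 `<=` K)%fset -> forall x,
    normc (f x - trigpoly K fhat x) <= e.
Proof.
move=> e0.
have [K0 hK0] := @fset_sum_tail R _ (fun k => normc (fhat k)) (fun k => normc_ge0 _) abs_summable _ e0.
exists K0 => K K0K x; apply/ler_addgt0Pr => e' e'0.
(* [A0] depends on x, but the terms of [A0] outside [K] add up to at most e for every x, and e' is
   arbitrary. *)
have [_ _ hs _] := fK; have [A0 hA0] := hs x e' e'0.
have {}hA0 := hA0 (A0 `|` K)%fset (fsubsetUl _ _).
rewrite (@big_fsetU_diff _ _ K) ?fsubsetUr// in hA0.
set T := \sum_(i <- ((A0 `|` K) `\` K)%fset) _ in hA0.
have hT : normc T <= e.
  apply: le_trans (normc_sum _ _) _.
  under eq_bigr do rewrite Normc.normcM normc_cexp2pi mulr1.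
  exact: hK0.
rewrite (_ : _ - _ = T - (trigpoly K fhat x + T - f x)); last by ring.
apply: le_trans (le_normcD _ _) _; apply: lerD => //.
by rewrite normcN; exact: ltW.
Qed.

Lemma sqr_poweR12 (x : \bar R) : (0 <= x -> (x `^ 2^-1) ^+ 2 = x)%E.
Proof.
case: x => [r| |]//; last by move=> _; rewrite poweRyr ?invr_neq0.
by rewrite lee_fin => r0; rewrite poweR_EFin powR12_sqrt// -EFin_expe sqr_sqrtr.
Qed.

Lemma L2norm_sqr (g : d.-tuple R -> R[i]) :
  (L2norm g ^+ 2 = \int[lebesgue_cube d]_x (normc (g x) ^+ 2)%:E)%E.
Proof.
rewrite /L2norm unlock sqr_poweR12; last by apply: integral_ge0 => x _; exact: poweR_ge0.
apply: eq_integral => x _.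
by rewrite /= ger0_norm ?normc_ge0// powR_mulrn ?normc_ge0.
Qed.

(** Replace f by a trigonometric polynomial over a large set containing [A], apply Parseval to the
    difference, and let the uniform error tend to 0. [T] accounts for the truncated coefficients. *)
Lemma L2norm_sqr_le (A : {fset d.-tuple int}) (c : d.-tuple int -> R[i]) (T : R) :
  (forall K : {fset d.-tuple int},
     \sum_(k <- (K `\` A)%fset) normc (fhat k) ^+ 2 <= T) ->
  (L2norm (fun x => (f x - \sum_(h <- A) c h * cexp2pi (dotp h x))%R) ^+ 2
   <= (T + \sum_(h <- A) normc (c h - fhat h) ^+ 2)%:E)%E.
Proof.
move=> hT; rewrite L2norm_sqr.
(* [M] bounds the polynomials [trigpoly K b] below uniformly in x and [K], so that the uniform error
   e changes the square by at most e (2 M + e). *)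
pose M := S + \sum_(h <- A) normc (c h).
have M0 : 0 <= M.
  apply: addr_ge0; last by apply: sumr_ge0 => *; exact: normc_ge0.
  by apply: fine_ge0; apply: esum_ge0 => k _; rewrite lee_fin normc_ge0.
have main e : 0 < e -> (\int[lebesgue_cube d]_x
    (normc (f x - \sum_(h <- A) c h * cexp2pi (dotp h x)) ^+ 2)%:E
    <= (T + \sum_(h <- A) normc (c h - fhat h) ^+ 2 + e * (2 * M + e))%:E)%E.
  move=> e0; have [K0 hK0] := korobov_approx e0.
  pose K := (K0 `|` A)%fset.
  have AK : (A `<=` K)%fset by exact: fsubsetUr.
  have {}hK0 := hK0 K (fsubsetUl _ _).
  pose b k := fhat k - (if k \in A then c k else 0).
  have bE x : trigpoly K b x = trigpoly K fhat x - \sum_(h <- A) c h * cexp2pi (dotp h x).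
    rewrite /trigpoly /b; under eq_bigr do rewrite mulrBl.
    rewrite sumrB; congr (_ - _).
    rewrite (big_fsetU_diff _ AK) [X in _ + X]big1_seq ?addr0.
      by apply: eq_big_seq => k ->.
    by move=> k /=; rewrite inE => /andP[/negbTE ->]; rewrite mul0r.
  have bM x : normc (trigpoly K b x) <= M.
    rewrite bE; apply: le_trans (le_normcD _ _) _; rewrite normcN; apply: lerD.
      apply: le_trans (normc_sum _ _) _.
      under eq_bigr do rewrite Normc.normcM normc_cexp2pi mulr1.
      exact: sum_normc_fhat.
    apply: le_trans (normc_sum _ _) _.
    by under eq_bigr do rewrite Normc.normcM normc_cexp2pi mulr1.
  have le1 x : normc (f x - \sum_(h <- A) c h * cexp2pi (dotp h x))
               <= normc (trigpoly K b x) + e.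
    rewrite bE (_ : f x - _ = (trigpoly K fhat x
      - \sum_(h <- A) c h * cexp2pi (dotp h x)) + (f x - trigpoly K fhat x)).
      by apply: le_trans (le_normcD _ _) _; rewrite lerD2l.
    by ring.
  apply: (@le_trans _ _ (\int[lebesgue_cube d]_x
      ((normc (trigpoly K b x) ^+ 2)%:E + (e * (2 * M + e))%:E)))%E.
    apply: ge0_le_integral_nomeas => x _; first by rewrite lee_fin sqr_ge0.
    rewrite -EFinD lee_fin.
    apply: (@le_trans _ _ ((normc (trigpoly K b x) + e) ^+ 2)).
      by rewrite ler_sqr ?nnegrE ?normc_ge0// addr_ge0 ?normc_ge0// ltW.
    have := bM x; have := normc_ge0 (trigpoly K b x); nra.
  rewrite ge0_integralD//; last 3 first.
  - by move=> x _; rewrite lee_fin sqr_ge0.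
  - by apply/measurable_EFinP; exact: measurable_normc_trigpoly.
  - by move=> x _; rewrite lee_fin mulr_ge0 ?addr_ge0 ?mulr_ge0// ltW.
  rewrite parseval ?fset_uniq// integral_cst//= [X in (_ * X)%E]probability_setT mule1.
  rewrite -EFinD lee_fin lerD2r.
  rewrite (big_fsetU_diff _ AK) addrC; apply: lerD.
    apply: le_trans (hT K); rewrite big_seq [leRHS]big_seq.
    apply: ler_sum => k; rewrite inE => /andP[kA _].
    by rewrite /b (negbTE kA) subr0.
  rewrite big_seq [leRHS]big_seq; apply: ler_sum => k kA.
  by rewrite /b kA -normcN opprB.
apply/lee_addgt0Pr => r r0; rewrite -EFinD.
(* The cap 1 gives e (2 M + e) <= e (2 M + 1), and the other bound makes this at most r. *)
pose e := Num.min 1 (r / (2 * M + 1)).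
have e0 : 0 < e by rewrite lt_min ltr01 divr_gt0// ltr_wpDl// mulr_ge0.
apply: le_trans (main e e0) _; rewrite lee_fin lerD2l.
apply: (@le_trans _ _ (e * (2 * M + 1))).
  by rewrite ler_pM2l// lerD2l ge_min lexx.
by rewrite -ler_pdivlMr ?ltr_wpDl ?mulr_ge0// ge_min lexx orbT.
Qed.

End approximation.

(** * Aliasing and medians *)

Section aliasing.
Variables (R : realType) (N : nat).
Hypothesis N_gt0 : (0 < N)%N.
Local Open Scope complex_scope.
Local Notation normc := Normc.normc.

Lemma cexp2piM_nat (j : nat) (t : R) : cexp2pi (j%:R * t) = cexp2pi t ^+ j.
Proof.
elim: j => [|j IH]; first by rewrite mul0r cexp2pi0.
by rewrite -natr1 mulrDl mul1r cexp2piD IH exprSr.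
Qed.

Lemma dotp_lattice_node d (l : d.-tuple int) (z : d.-tuple nat) (D : d.-tuple R) (j : nat) :
  dotp l (lattice_node N z D j) = j%:R * ((dotz l z)%:~R / N%:R) + dotp l D.
Proof.
rewrite /dotp /lattice_node /dotz.
under eq_bigr do rewrite tnth_mktuple mulrDr.
rewrite big_split /=; congr (_ + _).
rewrite rmorph_sum mulr_suml mulr_sumr; apply: eq_bigr => i _.
by rewrite rmorphM /= -pmulrn; ring.
Qed.

Lemma cexp2pi_eq1 (a : int) : (cexp2pi (a%:~R / N%:R : R) == 1) = (N%:Z %| a)%Z.
Proof.
have N0 : N%:R != 0 :> R by rewrite pnatr_eq0 -lt0n.
have -> : a%:~R / N%:R = (a %/ N)%Z%:~R + (a %% N)%Z%:~R / N%:R :> R.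
  rewrite {1}(divz_eq a N) intrD intrM mulrDl -[(Posz N)%:~R]pmulrn.
  by rewrite mulfK.
rewrite cexp2piD cexp2pi_int mul1r.
apply/eqP/dvdz_mod0P => [|->]; last by rewrite mul0r cexp2pi0.
have r0 : (0 <= a %% N)%Z by apply: modz_ge0; rewrite eqz_nat -lt0n.
have rN : ((a %% N)%Z < N)%R by apply: ltz_pmod; rewrite ltz_nat.
move=> e1; apply/eqP; apply: contra_eqT e1 => rn0.
apply: cexp2pi_neq1; rewrite divr_gt0 ?ltr0z ?ltr0n//; last by rewrite lt_def rn0.
by rewrite ltr_pdivrMr ?ltr0n// mul1r pmulrn ltr_int.
Qed.

(** With w = e(l . z / N), an N-th root of unity, the sum is geometric and vanishes unless w = 1,
    that is, unless l lies in the dual lattice. *)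
Lemma sum_lattice_node d (l : d.-tuple int) (z : d.-tuple nat) (D : d.-tuple R) :
  N%:R^-1 * \sum_(j < N) cexp2pi (dotp l (lattice_node N z D j))
  = if (N%:Z %| dotz l z)%Z then cexp2pi (dotp l D) else 0.
Proof.
under eq_bigr do rewrite dotp_lattice_node cexp2piD cexp2piM_nat.
rewrite -mulr_suml -cexp2pi_eq1.
set w := cexp2pi (_ / _).
have N0 : N%:R != 0 :> R[i] by rewrite pnatr_eq0 -lt0n.
have [->|w1] := eqVneq w 1.
  under eq_bigr do rewrite expr1n.
  by rewrite sumr_const card_ord mulrA mulVf ?mul1r.
have : w ^+ N - 1 = 0.
  rewrite /w -cexp2piM_nat mulrC mulfVK ?pnatr_eq0 -?lt0n//.
  by rewrite cexp2pi_int subrr.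
rewrite subrX1 => /eqP; rewrite mulf_eq0 subr_eq0 (negbTE w1) /= => /eqP ->.
by rewrite mul0r mulr0.
Qed.

Lemma frac_tuple_periodic d (f : d.-tuple R -> R[i]) (x : d.-tuple R) :
  one_periodic f -> f (frac_tuple x) = f x.
Proof.
move=> /(_ x [tuple - Num.floor (tnth x j) | j < d]) <-; congr f.
by apply: eq_from_tnth => j; rewrite !tnth_mktuple mulrNz.
Qed.

(** The aliasing formula is exact for the trigonometric polynomial. A lattice rule averages N values
    against factors of modulus 1, so the uniform error e is not amplified on passing to f. *)
Lemma lattice_coef_approx d (f : d.-tuple R -> R[i]) (K : {fset d.-tuple int})
    (a : d.-tuple int -> R[i]) (e : R) (z : d.-tuple nat) (D : d.-tuple R) (h : d.-tuple int) :
  one_periodic f ->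
  (forall x, normc (f x - trigpoly K a x) <= e) ->
  normc (lattice_coef N f (z, D) h
    - \sum_(k <- K) (if (N%:Z %| dotz (subt k h) z)%Z
                     then a k * cexp2pi (dotp (subt k h) D) else 0)) <= e.
Proof.
move=> fper fa; rewrite /lattice_coef /=.
set x := lattice_node N z D.
have -> : \sum_(k <- K) (if (N%:Z %| dotz (subt k h) z)%Z
                     then a k * cexp2pi (dotp (subt k h) D) else 0)
  = N%:R^-1 * \sum_(j < N) trigpoly K a (x j) * cexp2pi (- dotp h (x j)).
  under [in RHS]eq_bigr => j _.
    rewrite mulr_suml; under eq_bigr do rewrite -mulrA -cexp2piD -dotp_subt.
    over.
  rewrite exchange_big /= mulr_sumr; apply: eq_bigr => k _.
  rewrite -mulr_sumr mulrCA sum_lattice_node.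
  by case: ifP => _ //; rewrite mulr0.
under eq_bigr do rewrite frac_tuple_periodic//.
rewrite -mulrBr -sumrB Normc.normcM Normc.normcV.
have -> : normc (N%:R : R[i]) = N%:R.
  by rewrite (normcMn 1 N) Normc.normc1.
rewrite mulrC ler_pdivrMr ?ltr0n//.
apply: le_trans (normc_sum _ _) _.
apply: (@le_trans _ _ (\sum_(j < N) e)); last by rewrite sumr_const card_ord mulr_natr.
by apply: ler_sum => j _; rewrite -mulrBl Normc.normcM normc_cexp2pi mulr1.
Qed.

End aliasing.

(** * Robustness of the median *)

Section median.
Variable R : realType.
Local Open Scope complex_scope.
Local Notation normc := Normc.normc.

(** If the median of 2 n + 1 numbers exceeds c + t, so do the n + 1 sorted entries from it upwards;
    if it is below c - t, so are the n + 1 entries up to it. Either way more than half of the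
    entries are far from c. *)
Lemma median_close (s : seq R) (c t : R) : odd (size s) ->
  (count (fun x => t < `|x - c|)%R s <= (size s)./2)%N -> `|median s - c| <= t.
Proof.
move=> os Hc; rewrite leNgt; apply/negP => Hm; move: Hc; rewrite leqNgt => /negP; apply.
set P := fun x : R => t < `|x - c|.
set s' := sort <=%O s.
have ps : perm_eq s' s by rewrite perm_sort.
have ss : size s' = size s by rewrite size_sort.
have so : sorted <=%O s' by exact: sort_le_sorted.
have nle i j : (i <= j)%N -> (j < size s)%N -> nth 0 s' i <= nth 0 s' j.
  move=> ij js; apply: (sorted_leq_nth le_trans lexx) => //; rewrite ?inE ss//.
  exact: leq_ltn_trans ij js.
have szE : size s = ((size s)./2).*2.+1.
  by rewrite -[LHS]odd_double_half os.
set n := (size s)./2 in Hm szE *.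
rewrite -(permP ps).
move: Hm; rewrite /P /median -/s' -/n ltr_normr => /orP[Hm|Hm].
- rewrite -(cat_take_drop n s') count_cat.
  apply: leq_trans (leq_addl _ _).
  rewrite (_ : count P _ = size (drop n s')); first by rewrite size_drop ss; lia.
  apply/eqP; rewrite -all_count; apply/(all_nthP 0) => i; rewrite size_drop ss => hi.
  rewrite nth_drop /P ltr_normr; apply/orP; left; apply: lt_le_trans Hm _.
  by rewrite lerD2r; apply: nle; lia.
- rewrite -(cat_take_drop n.+1 s') count_cat.
  apply: leq_trans (leq_addr _ _).
  have st : size (take n.+1 s') = n.+1 by rewrite size_take ss; case: ifP; lia.
  rewrite (_ : count P _ = size (take n.+1 s')); first by rewrite st.
  apply/eqP; rewrite -all_count; apply/(all_nthP 0) => i; rewrite st => hi.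
  rewrite nth_take// /P ltr_normr; apply/orP; right; apply: lt_le_trans Hm _.
  by rewrite lerN2 lerD2r; apply: nle; lia.
Qed.

Lemma Re_le_normc (z : R[i]) : `|complex.Re z| <= normc z.
Proof.
by case: z => a b /=; rewrite -sqrtr_sqr ler_wsqrtr// lerDl sqr_ge0.
Qed.

Lemma Im_le_normc (z : R[i]) : `|complex.Im z| <= normc z.
Proof.
by case: z => a b /=; rewrite -sqrtr_sqr ler_wsqrtr// lerDr sqr_ge0.
Qed.

(** Real and imaginary parts each deviate by no more than the complex number does, so the scalar
    bound applies to both; the two squares give the factor 2. *)
Lemma cmedian_close (s : seq R[i]) (c : R[i]) (t : R) : odd (size s) ->
  (count (fun x => (t < normc (x - c))%R) s <= (size s)./2)%N ->
  normc (cmedian s - c) ^+ 2 <= 2 * t ^+ 2.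
Proof.
move=> os hs; rewrite normc_sqr mulr_natl mulr2n.
have sq (x : R) : `|x| <= t -> x ^+ 2 <= t ^+ 2.
  by move=> xt; rewrite -real_normK ?num_real// ler_sqr// nnegrE (le_trans _ xt).
case: c hs => c1 c2 hs /=.
apply: lerD; apply: sq; apply: median_close; rewrite size_map// count_map;
  apply: leq_trans hs; apply: sub_count => -[x y] /= H; apply: lt_le_trans H _.
- exact: (Re_le_normc ((x +i* y) - (c1 +i* c2))).
- exact: (Im_le_normc ((x +i* y) - (c1 +i* c2))).
Qed.

End median.

(** * Size of the index set *)

Section zeta.
Variable R : realType.
Implicit Types (s : R).

(** From ln(1 - 1/(b+1)) <= -1/(b+1) follows b^(-s) >= (b+1)^(-s) exp(s/(b+1)) >= (b+1)^(-s) (1 +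
    s/(b+1)). *)
Lemma powR_telescope s (b : nat) : 0 < s -> (0 < b)%N ->
  (b.+1)%:R `^ (- (1 + s)) <= s^-1 * (b%:R `^ (- s) - (b.+1)%:R `^ (- s)).
Proof.
move=> s0 b0.
have b1 : 0 < b.+1%:R :> R by rewrite ltr0n.
have b'0 : 0 < b%:R :> R by rewrite ltr0n.
rewrite mulrC ler_pdivlMr// opprD powRD; last by apply/implyP => _; rewrite gt_eqF.
rewrite powR_inv1 ?ler0n// lerBrDr.
have -> : b.+1%:R^-1 * b.+1%:R `^ (- s) * s + b.+1%:R `^ (- s)
  = b.+1%:R `^ (- s) * (1 + s / b.+1%:R) :> R by ring.
rewrite /powR !gt_eqF//.
apply: (@le_trans _ _ (expR (- s * ln b.+1%:R) * expR (s / b.+1%:R))).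
  by rewrite ler_pM2l ?expR_gt0// expR_ge1Dx.
rewrite -expRD ler_expR.
have h : ln (b%:R : R) <= ln b.+1%:R - b.+1%:R^-1.
  have -> : b%:R = b.+1%:R * (1 + - b.+1%:R^-1) :> R.
    by rewrite mulrDr mulr1 mulrN mulfV ?gt_eqF// -natr1 addrK.
  have bl : -1 < - b.+1%:R^-1 :> R.
    by rewrite ltrN2 invf_lt1// ltr1n.
  rewrite lnM ?posrE//; first by rewrite lerD2l le_ln1Dx.
  by rewrite -ltrBlDl sub0r.
rewrite !mulNr addrC -mulrBr -mulrN ler_pM2l// lerNr opprB.
by [].
Qed.

Lemma zeta_partial_le s (b : nat) : 0 < s ->
  \sum_(k < b) (k.+1)%:R `^ (- (1 + s)) <= 1 + s^-1.
Proof.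
move=> s0; case: b => [|b]; first by rewrite big_ord0 addr_ge0// invr_ge0 ltW.
(* The induction keeps the remainder of the telescoping sum. *)
suff H : \sum_(k < b.+1) (k.+1)%:R `^ (- (1 + s)) <= 1 + s^-1 - s^-1 * b.+1%:R `^ (- s).
  by apply: le_trans H _; rewrite gerBl mulr_ge0 ?powR_ge0// invr_ge0 ltW.
elim: b => [|b IH]; first by rewrite big_ord1 !powR1 mulr1 addrK.
rewrite big_ord_recr /=; apply: le_trans (lerD IH (powR_telescope s0 (ltn0Sn b))) _.
by rewrite mulrBr addrA subrK.
Qed.

End zeta.

Section box.
Variable R : realType.

(** The index i is a shifted integer running from -B to B, and [v] sees only its absolute value. *)
Lemma sum_box (v : nat -> R) (B : nat) :
  \sum_(i < B.*2.+1) v `|i%:Z - B%:Z|%N = v 0%N + 2 * \sum_(k < B) v k.+1.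
Proof.
elim: B => [|B IH]; first by rewrite double0 big_ord_recl !big_ord0 mulr0.
rewrite doubleS big_ord_recr big_ord_recl /= /bump /=.
have e1 i : `|(1 + i)%N%:Z - B.+1%:Z|%N = `|i%:Z - B%:Z|%N by lia.
under eq_bigr do rewrite e1.
rewrite IH big_ord_recr /=.
rewrite subn0.
rewrite (_ : `|(B.*2.+2)%:Z - B.+1%:Z|%N = B.+1); last by lia.
ring.
Qed.

(** The right side expands into a sum over all integer points of the box; [phi] embeds [A] into it
    and the remaining terms are nonnegative. *)
Lemma sum_fset_prod_le d (A : {fset d.-tuple int}) (B : nat) (w : 'I_d -> int -> R) :
  (forall j n, 0 <= w j n) ->
  (forall h, h \in A -> forall j, (`|tnth h j| <= B)%N) ->
  \sum_(h <- A) \prod_(j < d) w j (tnth h j)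
  <= \prod_(j < d) \sum_(i < B.*2.+1) w j (i%:Z - B%:Z).
Proof.
move=> w0 AB; rewrite bigA_distr_bigA /=.
pose phi (h : d.-tuple int) : {ffun 'I_d -> 'I_B.*2.+1} :=
  [ffun j => inord `|tnth h j + B%:Z|].
have phiK h : h \in A -> forall j, (phi h j)%:Z - B%:Z = tnth h j.
  move=> hA j; have := AB h hA j; rewrite ffunE; move: (tnth h j) => t hB.
  by rewrite inordK -?addnn; lia.
have phiI : {in A &, injective phi}.
  move=> h h' hA h'A hh'; apply: eq_from_tnth => j.
  by rewrite -(phiK h)// -(phiK h')// hh'.
rewrite (eq_big_seq (fun h => \prod_(j < d) w j ((phi h j)%:Z - B%:Z))); last first.
  by move=> h hA; apply: eq_bigr => j _; rewrite phiK.
rewrite -(big_map phi xpredT (fun g : {ffun 'I_d -> 'I_B.*2.+1} => \prod_(j < d) w j ((g j)%:Z - B%:Z))).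
rewrite big_uniq /=; last by rewrite map_inj_in_uniq// fset_uniq.
rewrite big_mkcond /=; apply: ler_sum => g _; case: ifP => // _.
by apply: prodr_ge0 => j _; exact: w0.
Qed.

Lemma fset_tuple_bounded d (A : {fset d.-tuple int}) :
  exists B : nat, forall h, h \in A -> forall j, (`|tnth h j| <= B)%N.
Proof.
exists (\sum_(h <- A) \sum_(j < d) `|tnth h j|)%N => h hA j.
rewrite (big_fsetD1 h)//= (bigD1 j)//= -addnA; exact: leq_addr.
Qed.

End box.

Section card.
Variables (R : realType) (alpha : R) (gamma : nat -> R).
Hypothesis alpha_gt : 2^-1 < alpha.
Hypothesis gamma_gt0 : forall j, 0 < gamma j.
Hypothesis gamma_le1 : forall j, gamma j <= 1.

Local Notation gam j := (gamma j `^ (2 * alpha)^-1).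

Let a2_gt0 : 0 < 2 * alpha.
Proof. by rewrite mulr_gt0// (lt_trans _ alpha_gt). Qed.

Lemma powR_one (p : R) : 1 `^ p = 1.
Proof. by rewrite powR1. Qed.

Lemma korobov_factor_ge1 (j : nat) (n : R) : 1 <= Num.max (`|n| `^ (2 * alpha) / gamma j) 1.
Proof. by rewrite le_max lexx orbT. Qed.

Lemma korobov_weight_ge1 d (h : d.-tuple int) : 1 <= korobov_weight alpha gamma h.
Proof.
rewrite /korobov_weight; elim/big_ind: _ => // [x y x1 y1|j _]; last exact: korobov_factor_ge1.
by rewrite -[1]mulr1 ler_pM.
Qed.

Lemma powR_prod I (s : seq I) (F : I -> R) (p : R) : (forall i, 0 <= F i) ->
  (\prod_(i <- s) F i) `^ p = \prod_(i <- s) F i `^ p.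
Proof.
move=> F0; elim: s => [|i s IH]; first by rewrite !big_nil powR1.
by rewrite !big_cons powRM ?IH// prodr_ge0.
Qed.

(* Rankin's trick: bound the indicator of [korobov_weight h <= L^(2 alpha)] by
   [(L^(2 alpha) / korobov_weight h)^(q / (2 alpha))] with q = 1 + 1 / (tau ln N), for
   which L^(q - 1) <= exp(1 / tau) and zeta(q) <= 1 + tau ln N. *)
Lemma card_index_le d (N : nat) (tau L : R) (A : {fset d.-tuple int}) :
  (1 < N)%N -> 0 < tau -> 0 < L <= N%:R ->
  (forall h, h \in A -> korobov_weight alpha gamma h <= L `^ (2 * alpha)) ->
  (#|` A|)%:R <= L * (expR tau^-1 * P_N alpha gamma d N tau).
Proof.
move=> N1 tau0 /andP[L0 LN] hA.
have lnN : 0 < ln (N%:R : R) by rewrite ln_gt0// ltr1n.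
pose s := (tau * ln (N%:R : R))^-1.
have s0 : 0 < s by rewrite invr_gt0 mulr_gt0.
pose q := 1 + s.
have q1 : 1 <= q by rewrite lerDl ltW.
pose p := q / (2 * alpha).
have p0 : 0 <= p by rewrite divr_ge0 ?(le_trans _ q1)// ltW.
have ap : 2 * alpha * p = q by rewrite /p mulrC divfK// gt_eqF.
pose m (j : nat) (n : int) : R := Num.max (`|n%:~R : R| `^ (2 * alpha) / gamma j) 1.
have m1 j n : 1 <= m j n by exact: korobov_factor_ge1.
have m0 j n : 0 <= m j n by apply: le_trans (m1 j n).
pose w (j : nat) (n : int) : R := (m j n `^ p)^-1.
have w0 j n : 0 <= w j n by rewrite invr_ge0 powR_ge0.
have mp1 j n : 1 <= m j n `^ p.
  by rewrite -[leLHS](powR_one p) ge0_ler_powR// nnegrE.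
have [B hB] := fset_tuple_bounded A.
have LqE : L `^ q <= L * expR tau^-1.
  rewrite /q powRD; last by apply/implyP => _; rewrite gt_eqF.
  rewrite powRr1 ?(ltW L0)// ler_pM2l//.
  apply: (@le_trans _ _ (N%:R `^ s)).
    by rewrite ge0_ler_powR ?nnegrE// ltW.
  rewrite /powR gt_eqF ?ltr0n ?(ltnW N1)// /s ler_expR invfM.
  by rewrite -mulrA mulVf ?mulr1// gt_eqF.
have wprod (h : d.-tuple int) : \prod_(j < d) w j (tnth h j) = (korobov_weight alpha gamma h `^ p)^-1.
  rewrite /korobov_weight powR_prod; last by move=> i; exact: m0.
  by rewrite (big_morph _ (@invfM R) (@invr1 R)).
have step1 : (#|` A|)%:R <= L `^ q * \sum_(h <- A) \prod_(j < d) w j (tnth h j).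
  rewrite mulr_sumr.
  apply: (@le_trans _ _ (\sum_(h <- A) 1)).
    by rewrite big_const_seq count_predT iter_addr_0.
  rewrite big_seq [leRHS]big_seq; apply: ler_sum => h /hA hh.
  rewrite wprod ler_pdivlMr ?mul1r; last first.
    by apply: powR_gt0; apply: lt_le_trans (korobov_weight_ge1 h).
  rewrite -ap powRrM ge0_ler_powR// nnegrE ?powR_ge0//.
  by apply: le_trans (korobov_weight_ge1 h).
have step2 := @sum_fset_prod_le R d A B (fun j n => w j n) (fun j n => w0 j n) hB.
apply: (le_trans step1).
apply: (@le_trans _ _ (L `^ q * \prod_(j < d) (1 + 2 * gam j * (1 + tau * ln N%:R)))); last first.
  rewrite mulrA ler_wpM2r// prodr_ge0// => j _.
  by rewrite addr_ge0// !mulr_ge0 ?powR_ge0// addr_ge0// ltW// mulr_gt0.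
rewrite ler_wpM2l ?powR_ge0//; apply: (le_trans step2).
apply: ler_prod => j _; apply/andP; split; first exact: sumr_ge0.
pose v (k : nat) : R := if k == 0%N then 1 else gam j * k%:R `^ (- (1 + s)).
have wv (n : int) : w j n <= v `|n|%N.
  rewrite /v; case: eqP => [_|/eqP n0].
    by rewrite /w invf_le1// (lt_le_trans _ (mp1 j n)).
  have n0' : (0 : R) < `|n|%N%:R by rewrite ltr0n lt0n.
  have e1 : `|n%:~R : R| = `|n|%N%:R by rewrite natr_absz intr_norm.
  rewrite powRN -[gam j * _]invrK invfM invrK lef_pV2; last 2 first.
  - by rewrite posrE (lt_le_trans _ (mp1 j n)).
  - by rewrite posrE mulr_gt0 ?invr_gt0 ?powR_gt0.
  apply: (@le_trans _ _ ((`|n|%N%:R `^ (2 * alpha) / gamma j) `^ p)); last first.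
    rewrite ge0_ler_powR ?nnegrE//; first by rewrite divr_ge0 ?powR_ge0// ltW.
    by rewrite /m e1 le_max lexx.
  rewrite powRM ?powR_ge0 ?invr_ge0 ?(ltW (gamma_gt0 j))// -powRrM ap mulrC.
  rewrite -/q ler_wpM2l ?powR_ge0//.
  have -> : (gamma j)^-1 `^ p = (gamma j `^ p)^-1.
    by rewrite -powR_inv1 ?(ltW (gamma_gt0 j))// -powRrM mulN1r powRN.
  rewrite lef_pV2 ?posrE ?powR_gt0//.
  (* Since p = q / (2 alpha), the power is the q-th power of a number in (0, 1], and q >= 1. *)
  rewrite /p mulrC powRrM ge1r_powR// powR_gt0//=.
  rewrite -[leRHS](powR_one (2 * alpha)^-1) ge0_ler_powR ?nnegrE ?invr_ge0 ?(ltW a2_gt0) ?(ltW (gamma_gt0 j))//.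
apply: (@le_trans _ _ (\sum_(i < B.*2.+1) v `|i%:Z - B%:Z|%N)).
  by apply: ler_sum => i _; exact: wv.
rewrite sum_box /v /= lerD2l -mulr_sumr mulrA ler_wpM2l ?mulr_ge0 ?powR_ge0//.
apply: le_trans (zeta_partial_le _ s0) _.
by rewrite invrK.
Qed.

End card.

(** * Failure probabilities *)

(** Singletons are finite intersections of coordinate preimages, and the space is countable. *)
Lemma measurable_tuple_nat n (A : set (n.-tuple nat)) : measurable A.
Proof.
have m1 (z : n.-tuple nat) : measurable [set z].
  rewrite (_ : [set z] = \big[setI/setT]_(j < n) ((fun x : n.-tuple nat => tnth x j) @^-1` [set tnth z j])).
    apply: bigsetI_measurable => j _.
    by rewrite -[X in measurable X]setTI; exact: measurable_tnth.
  rewrite -bigcap_seq; apply/seteqP; split => [x -> j _|x H]//=.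
  by apply: eq_from_tnth => j; by apply: (H j); rewrite /= mem_index_enum.
rewrite (_ : A = \bigcup_i (if choice.unpickle i is Some z then [set x | x = z /\ A z] else set0)).
  apply: bigcupT_measurable => i; case: choice.unpickle => // z.
  have [Az|nAz] := pselect (A z).
    by rewrite (_ : [set x | _] = [set z])//; apply/seteqP; split => x //= [].
  by rewrite (_ : [set x | _] = set0)//; apply/seteqP; split => x //= [].
apply/seteqP; split => [z Az|z [i _]]; first by exists (choice.pickle z) => //; rewrite choice.pickleK.
by case: choice.unpickle => // z' [-> ].
Qed.

Section counting_failures.
Context d (T : measurableType d) (R : realType) (P : probability T R).
Variables (Bad : set T) (p : R).
Hypotheses (mBad : measurable Bad) (p0 : 0 <= p) (PBad : (P Bad <= p%:E)%E).

Definition failures n (w : n.-tuple T) : nat := (\sum_(r < n) (tnth w r \in Bad))%N.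

Lemma failures_cons n (x : T) (w : n.-tuple T) :
  failures (cons_pair (x, w)) = ((x \in Bad) + failures w)%N.
Proof.
rewrite /failures big_ord_recl /cons_pair !tnth0; congr (_ + _)%N.
by apply: eq_bigr => j _; rewrite !tnthS.
Qed.

Lemma measurable_failures n (s : nat) :
  measurable [set w : n.-tuple T | (s <= failures w)%N].
Proof.
have mF : measurable_fun [set: n.-tuple T] (fun w : n.-tuple T => \sum_(r < n) (\1_Bad (tnth w r) : R)).
  apply: measurable_sum => r; apply: measurableT_comp; last exact: measurable_tnth.
  exact: measurable_indic.
have E (w : n.-tuple T) : \sum_(r < n) (\1_Bad (tnth w r) : R) = (failures w)%:R.
  by rewrite /failures natr_sum; apply: eq_bigr => r _; rewrite indicE.
have := mF measurableT `[s%:R, +oo[%classic (measurable_itv _).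
rewrite setTI; congr (measurable _).
by apply/seteqP; split => w; rewrite /= in_itv/= andbT E ler_nat.
Qed.

(** This is the union bound over the s-element sets of draws, obtained by conditioning on the first
    draw: a bad one leaves s of the s + 1 failures to find, a good one all of them, and Pascal's
    rule recombines the terms. *)
Lemma power_prob_failures n (s : nat) :
  (power_prob P n [set w | (s <= failures w)%N] <= ('C(n, s)%:R * p ^+ s)%:E)%E.
Proof.
elim: n s => [|n IH] s.
  case: s => [|s].
    by rewrite bin0 expr0 mulr1; apply: probability_le1; exact: measurable_failures.
  rewrite (_ : [set w | _] = set0) ?measure0 ?lee_fin ?mulr_ge0 ?exprn_ge0//.
  by apply/seteqP; split => w //=; rewrite /failures big_ord0.
case: s => [|s].
  by rewrite bin0 expr0 mulr1; apply: probability_le1; exact: measurable_failures.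
rewrite power_probS.
pose c1 := 'C(n, s)%:R * p ^+ s; pose c2 := 'C(n, s.+1)%:R * p ^+ s.+1.
have c10 : 0 <= c1 by rewrite mulr_ge0 ?exprn_ge0.
have c20 : 0 <= c2 by rewrite mulr_ge0 ?exprn_ge0.
apply: (@le_trans _ _ (\int[P]_x (c1%:E * (\1_Bad x)%:E + c2%:E))%E).
  apply: ge0_le_integral_nomeas => x _; first exact: measure_ge0.
  under [X in power_prob P n X]eq_set do rewrite /= failures_cons.
  rewrite indicE; case: (x \in Bad); rewrite ?(mule1, mule0, add0e).
    apply: le_trans (IH s) _; rewrite leeDl// lee_fin//.
  exact: IH s.+1.
rewrite ge0_integralD//; last first.
- by apply: measurable_funeM; apply/measurable_EFinP; exact: measurable_indic.
- by move=> x _; rewrite mule_ge0// lee_fin.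
rewrite ge0_integralZl_EFin//; last by apply/measurable_EFinP; exact: measurable_indic.
rewrite integral_indic// setIT integral_cst//= [X in (_ + _ * X)%E]probability_setT mule1.
apply: (@le_trans _ _ (c1%:E * p%:E + c2%:E)%E).
  by rewrite leeD2r// lee_wpmul2l// lee_fin.
rewrite -EFinM -EFinD lee_fin binS natrD mulrDl addrC lerD2l.
by rewrite /c1 exprSr mulrA.
Qed.

End counting_failures.

(** * Probability that a draw is bad for a given frequency *)

Section bad_set.
Variables (R : realType) (N d : nat).
Local Open Scope complex_scope.
Local Notation normc := Normc.normc.
Local Notation PZ := (power_prob (uniform_pos N : probability nat R) d).
Local Notation PD := (@lebesgue_cube R d).
Variables (h : d.-tuple int) (B K : {fset d.-tuple int}) (a : d.-tuple int -> R[i]) (T : R).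

Definition aliased (k : d.-tuple int) (z : d.-tuple nat) : bool := (N%:Z %| dotz (subt k h) z)%Z.

Definition alias_coef (z : d.-tuple nat) (k : d.-tuple int) : R[i] :=
  if aliased k z then a k else 0.

(* A draw is bad for h if its dual lattice moves a frequency of B onto h, or if
   the frequencies of K that it moves onto h contribute too much. *)
Definition bad_set : set (d.-tuple nat * d.-tuple (measurableTypeR R)) :=
  [set zD | (exists2 k, k \in B & aliased k zD.1)
            \/ T <= normc (trigpoly K (alias_coef zD.1) zD.2) ^+ 2].

(** The expanded square is a finite sum of products of an indicator in z, where every set is
    measurable, and a measurable function of the shift. *)
Lemma measurable_alias_trigpoly :
  measurable_fun [set: d.-tuple nat * d.-tuple (measurableTypeR R)]
    (fun zD => normc (trigpoly K (alias_coef zD.1) zD.2) ^+ 2).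
Proof.
have E zD : normc (trigpoly K (alias_coef zD.1) zD.2) ^+ 2
  = \sum_(k <- K) \sum_(l <- K) \1_[set z | aliased k z /\ aliased l z] zD.1
      * complex.Re (a k * (a l)^* * cexp2pi (dotp (subt k l) zD.2)).
  rewrite normc_trigpoly; apply: eq_bigr => k _; apply: eq_bigr => l _.
  rewrite /alias_coef indicE.
  case: (boolP (zD.1 \in _)); rewrite ?inE ?notin_setE /=.
    by move=> [-> ->]; rewrite mul1r.
  case: (aliased k _); last by rewrite mul0r mul0r mul0r.
  case: (aliased l _) => H; last first.
    by rewrite rmorph0 mulr0 !mul0r.
  by exfalso; apply: H.
under eq_fun do rewrite E.
apply: measurable_sum => k; apply: measurable_sum => l; apply: measurable_funM.
  pose i1 := (\1_[set z | aliased k z /\ aliased l z] : d.-tuple nat -> R).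
  have mi1 : measurable_fun [set: d.-tuple nat] i1.
    by apply: measurable_indic; exact: measurable_tuple_nat.
  exact: (measurableT_comp mi1 measurable_fst).
pose g (D : d.-tuple (measurableTypeR R)) : R :=
  complex.Re (a k * (a l)^* * cexp2pi (dotp (subt k l) D)).
suff mg : measurable_fun [set: d.-tuple (measurableTypeR R)] g.
  exact: (measurableT_comp mg measurable_snd).
by apply/measurable_EFinP; case/integrableP: (integrable_Re_cexp2pi (a k * (a l)^*) (subt k l)).
Qed.

Lemma measurable_bad_set : measurable bad_set.
Proof.
rewrite (_ : bad_set = fst @^-1` [set z | exists2 k, k \in B & aliased k z]
  `|` (fun zD : d.-tuple nat * d.-tuple (measurableTypeR R) =>
         normc (trigpoly K (alias_coef zD.1) zD.2) ^+ 2) @^-1` `[T, +oo[%classic); last first.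
  by apply/seteqP; split => zD /=; rewrite /bad_set /= in_itv/= andbT.
apply: measurableU.
  rewrite -[X in measurable X]setTI; apply: measurable_fst => //.
  exact: measurable_tuple_nat.
by rewrite -[X in measurable X]setTI; apply: measurable_alias_trigpoly.
Qed.

(** For fixed z, either some frequency of [B] is aliased and the first sum is at least 1, or only
    the second clause of [bad_set] can hold, and Markov's inequality with Parseval in the shift
    gives the second sum. *)
Lemma xsection_bad_set_le (z : d.-tuple nat) : 0 < T ->
  (PD (xsection bad_set z) <=
   (\sum_(k <- B) (aliased k z)%:R
    + T^-1 * \sum_(k <- K) (aliased k z)%:R * normc (a k) ^+ 2)%:E)%E.
Proof.
move=> T0.
have S0 : 0 <= \sum_(k <- K) (aliased k z)%:R * normc (a k) ^+ 2.
  by apply: sumr_ge0 => k _; rewrite mulr_ge0 ?sqr_ge0.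
have [[k kB ak]|nB] := pselect (exists2 k, k \in B & aliased k z).
  apply: (@le_trans _ _ 1%E).
    by apply: probability_le1; apply: measurable_xsection; exact: measurable_bad_set.
  rewrite lee_fin -[leLHS]addr0 lerD ?mulr_ge0 ?invr_ge0 ?(ltW T0)//.
  rewrite (big_fsetD1 k)//= ak lerDl; exact: sumr_ge0.
pose g (D : d.-tuple (measurableTypeR R)) : \bar R := (normc (trigpoly K (alias_coef z) D) ^+ 2)%:E.
have mg : measurable_fun setT g by apply/measurable_EFinP; exact: measurable_normc_trigpoly.
have := @le_integral_abse _ _ _ PD setT measurableT g T mg T0.
have -> : (\int[PD]_x `|g x|)%E = (\sum_(k <- K) (aliased k z)%:R * normc (a k) ^+ 2)%:E.
  rewrite -(_ : \sum_(k <- K) normc (alias_coef z k) ^+ 2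
      = \sum_(k <- K) (aliased k z)%:R * normc (a k) ^+ 2); last first.
    apply: eq_bigr => k _; rewrite /alias_coef; case: (aliased k z); rewrite ?mul1r//.
    by rewrite Normc.normc0 expr0n mul0r.
  rewrite -parseval ?fset_uniq//; apply: eq_integral => D _.
  by rewrite /g gee0_abs// lee_fin sqr_ge0.
rewrite setTI => H.
have -> : xsection bad_set z = [set D | (T%:E <= `|g D|)%E].
  have gE D : (T%:E <= `|g D|)%E = (T <= normc (trigpoly K (alias_coef z) D) ^+ 2).
    by rewrite gee0_abs ?lee_fin ?sqr_ge0.
  apply/seteqP; split => D; rewrite /xsection /mkset inE gE.
    by case => // /nB.
  by right.
apply: (@le_trans _ _ (T^-1 * \sum_(k <- K) (aliased k z)%:R * normc (a k) ^+ 2)%:E).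
  by rewrite EFinM lee_pdivlMl.
by rewrite lee_fin lerDr sumr_ge0.
Qed.

Lemma bad_set_le (p : d.-tuple int -> R) : 0 < T ->
  (forall k, (PZ [set z | aliased k z] <= (p k)%:E)%E) ->
  ((PZ \x PD)%E bad_set <=
   (\sum_(k <- B) p k + T^-1 * \sum_(k <- K) p k * normc (a k) ^+ 2)%:E)%E.
Proof.
move=> T0 hp.
have iE k (c : R) : 0 <= c -> (\int[PZ]_z (c%:E * (\1_[set z | aliased k z] z)%:E)
    <= (p k * c)%:E)%E.
  move=> c0; rewrite ge0_integralZl_EFin//; last first.
    by apply/measurable_EFinP; apply: measurable_indic; exact: measurable_tuple_nat.
  rewrite integral_indic//; last exact: measurable_tuple_nat.
  rewrite setIT [p k * c]mulrC EFinM.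
  by apply: lee_wpmul2l; [rewrite lee_fin|exact: hp].
pose F k (c : R) z : \bar R := (c%:E * (\1_[set z | aliased k z] z)%:E)%E.
have mF k c : measurable_fun setT (F k c).
  apply: measurable_funeM; apply/measurable_EFinP; apply: measurable_indic; exact: measurable_tuple_nat.
have F0 k c z : 0 <= c -> (0 <= F k c z)%E by move=> c0; rewrite mule_ge0// lee_fin.
have aE k z : (aliased k z)%:R = \1_[set z | aliased k z] z :> R.
  by rewrite indicE; congr (nat_of_bool _)%:R; apply/idP/idP; rewrite inE.
apply: (@le_trans _ _ (\int[PZ]_z (\sum_(k <- B) F k 1%R z + \sum_(k <- K) F k (T^-1 * normc (a k) ^+ 2)%R z))%E).
  apply: ge0_le_integral_nomeas => z _; first exact: measure_ge0.
  apply: le_trans (xsection_bad_set_le z T0) _.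
  rewrite EFinD mulr_sumr -!sumEFin; apply: leeD; apply: lee_sum => k _.
    by rewrite /F mul1e aE.
  by rewrite /F aE -EFinM lee_fin mulrCA mulrC.
have c0 k : 0 <= T^-1 * normc (a k) ^+ 2 by rewrite mulr_ge0 ?sqr_ge0// invr_ge0 ltW.
rewrite ge0_integralD//; last 4 first.
- by move=> z _; apply: sume_ge0 => k _; exact: F0.
- by apply: emeasurable_sum => k; exact: mF.
- by move=> z _; apply: sume_ge0 => k _; exact: F0.
- by apply: emeasurable_sum => k; exact: mF.
rewrite !ge0_integral_sum//; [|by move=> *; exact: F0..].
rewrite EFinD mulr_sumr -!sumEFin; apply: leeD; apply: lee_sum => k _.
  by rewrite -[p k]mulr1; exact: (iE k 1 ler01).
by rewrite [T^-1 * (p k * _)]mulrCA; exact: (iE k _ (c0 k)).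
Qed.

End bad_set.

Lemma bin_le_exp2 (n s : nat) : ('C(n, s) <= 2 ^ n)%N.
Proof.
elim: n s => [|n IH] [|s] //; first by rewrite bin0 expn_gt0.
by rewrite binS expnS mul2n -addnn leq_add.
Qed.

Lemma probability_setC_bigU_ge d (T : measurableType d) (R : realType)
    (P : probability T R) (I : choiceType) (A : {fset I}) (U : I -> set T) (c : R) :
  (forall i, i \in A -> measurable (U i)) -> (forall i, i \in A -> (P (U i) <= c%:E)%E) ->
  ((1 - (#|` A|)%:R * c)%:E <= P [set x | forall i, i \in A -> ~ U i x])%E.
Proof.
move=> mU Uc.
have mB (s : seq I) : {subset s <= A} -> measurable (\big[setU/set0]_(i <- s) U i).
  move=> sA; rewrite big_seq; apply: bigsetU_measurable => i /sA; exact: mU.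
have le (s : seq I) : {subset s <= A} ->
    (P (\big[setU/set0]_(i <- s) U i) <= ((size s)%:R * c)%:E)%E.
  elim: s => [|i s IH] sA; first by rewrite big_nil measure0 mul0r.
  have sA' : {subset s <= A} by move=> j js; apply: sA; rewrite inE js orbT.
  have iA : i \in A by apply: sA; rewrite mem_head.
  rewrite big_cons; apply: le_trans (measureU2 _ (mU _ iA) (mB _ sA')) _.
  by rewrite /= -natr1 mulrDl mul1r [_ + c]addrC EFinD; apply: leeD; [exact: Uc|exact: IH].
rewrite (_ : [set x | _] = ~` \big[setU/set0]_(i <- A) U i); last first.
  rewrite -bigcup_seq; apply/seteqP; split => x /= H; first by move=> [i iA Ux]; exact: (H i iA).
  by move=> i iA Ux; apply: H; exists i.
rewrite probability_setC; last exact: mB.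
by rewrite EFinB leeB// le.
Qed.

(** * Error analysis for abstract frequency sets A and B *)

Section core.
Variables (R : realType) (alpha : R) (gamma : nat -> R) (N d n : nat).
Variable f : d.-tuple R -> R[i].
Hypothesis fK : korobov_space alpha gamma f.
Variables (A B : {fset d.-tuple int}) (V : R).
Local Open Scope complex_scope.
Local Notation normc := Normc.normc.
Local Notation fhat := (fourier f).
Local Notation m := n.*2.+1.

Definition congruent (k h : d.-tuple int) : bool := [forall j, (N%:Z %| tnth (subt k h) j)%Z].

Hypothesis pN : prime N.
Hypothesis BA : (B `<=` A)%fset.
Hypothesis cardA : (#|` A| <= N.-1)%N.
Hypothesis cardB : (128 * #|` B| <= N.-1)%N.
Hypothesis distinct : forall h h', h \in A -> h' \in A -> congruent h h' -> h = h'.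
Hypothesis V0 : 0 < V.
Hypothesis tailV : forall K : {fset d.-tuple int}, \sum_(k <- (K `\` B)%fset) normc (fhat k) ^+ 2 <= V.

(** An upper bound for the probability that a draw aliases k to h; frequencies congruent mod N are
    aliased by every z. *)
Definition alias_prob (h k : d.-tuple int) : R := if congruent k h then 1 else (N.-1)%:R^-1.

Let N1 : (1 < N)%N. Proof. exact: prime_gt1. Qed.
Let Npred : 0 < (N.-1)%:R :> R. Proof. by rewrite ltr0n -subn1 subn_gt0. Qed.

Lemma alias_prob_ge0 h k : 0 <= alias_prob h k.
Proof. by rewrite /alias_prob; case: ifP; rewrite ?invr_ge0 ?ltW. Qed.

Lemma aliased_prob_le h k :
  (power_prob (uniform_pos N : probability nat R) d [set z | aliased N h k z]
    <= (alias_prob h k)%:E)%E.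
Proof.
rewrite /alias_prob; case: ifPn => [_|].
  by apply: probability_le1; exact: measurable_tuple_nat.
rewrite negb_forall => /existsP nc.
have := @power_uniform_dvd R N N1 d (subt k h) 0 pN nc.
by congr (_ <= _)%E; congr (power_prob _ _ _); apply/seteqP; split => z;
  rewrite /dvdset /aliased /= addr0.
Qed.

(** Elements of [A] are pairwise incongruent, so at most one is congruent to k and contributes an
    additional 1; the terms 1 / (N - 1) add up to at most 1 because [A] has at most N - 1
    elements. *)
Lemma sum_alias_prob_le k : \sum_(h <- A) alias_prob h k <= 2.
Proof.
apply: (@le_trans _ _ (\sum_(h <- A) ((congruent k h)%:R + (N.-1)%:R^-1))).
  apply: ler_sum => h _; rewrite /alias_prob; case: (congruent k h).
    by rewrite lerDl invr_ge0 ltW.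
  by rewrite add0r.
rewrite big_split /= -[leRHS]/(1 + 1); apply: lerD.
  have [[h0 h0A ch0]|nc] := pselect (exists2 h0, h0 \in A & congruent k h0); last first.
    rewrite big1_seq ?ler01// => h hA; case: (boolP (congruent k h)) => // ch.
    by exfalso; apply: nc; exists h.
  rewrite (big_fsetD1 h0)//= ch0 big1_seq ?addr0// => h /=; rewrite !inE => /andP[hh0 hA].
  case: (boolP (congruent k h)) => // ch; move/eqP: hh0 => []; apply: distinct => //.
  apply/forallP => j; move/forallP: ch => /(_ j); move/forallP: ch0 => /(_ j).
  rewrite !tnth_mktuple => c0 c1.
  rewrite (_ : _ - _ = (tnth k j - tnth h0 j) - (tnth k j - tnth h j)); last by ring.
  exact: rpredB.
by rewrite big_const_seq count_predT iter_addr_0 -[leLHS]mulr_natl ler_pdivrMr// mul1r ler_nat.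
Qed.

(** Chosen so that 8 eps^2 = V / N: summed over [A], the approximation error costs at most one
    further V. *)
Let eps := Num.sqrt (V / (8 * N%:R)).

Let eps2 : eps ^+ 2 = V / (8 * N%:R).
Proof. by rewrite sqr_sqrtr// divr_ge0 ?(ltW V0)// mulr_ge0. Qed.

Let eps0 : 0 < eps.
Proof. by rewrite sqrtr_gt0 divr_gt0// mulr_gt0// ltr0n (ltnW N1). Qed.

Variable K0 : {fset d.-tuple int}.
Hypothesis K0approx : forall K : {fset d.-tuple int}, (K0 `<=` K)%fset -> forall x,
    normc (f x - trigpoly K fhat x) <= eps.

Definition far (h : d.-tuple int) : {fset d.-tuple int} := (((K0 `|` A) `\` B) `\ h)%fset.

(* Bound on the mean square aliasing error at h over the draws whose dual lattice
   moves no frequency of B onto h. *)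
Definition mean_err (h : d.-tuple int) : R :=
  \sum_(k <- far h) alias_prob h k * normc (fhat k) ^+ 2.

(** The added eps^2 keeps the threshold positive even when [mean_err h] vanishes, as Markov's
    inequality requires. *)
Definition threshold (h : d.-tuple int) : R := 128 * mean_err h + eps ^+ 2.

Definition bad (h : d.-tuple int) : set (d.-tuple nat * d.-tuple (measurableTypeR R)) :=
  bad_set N h (B `\ h)%fset (far h) fhat (threshold h).

Lemma mean_err_ge0 h : 0 <= mean_err h.
Proof. by apply: sumr_ge0 => k _; rewrite mulr_ge0 ?alias_prob_ge0 ?sqr_ge0. Qed.

Lemma threshold_gt0 h : 0 < threshold h.
Proof. by rewrite ltr_wpDl ?exprn_gt0// mulr_ge0// mean_err_ge0. Qed.

Lemma bad_le h : h \in A ->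
  ((power_prob (uniform_pos N : probability nat R) d \x lebesgue_cube d)%E (bad h)
    <= (64^-1)%:E)%E.
Proof.
move=> hA.
have := @bad_set_le R N d h (B `\ h)%fset (far h) fhat _ _ (threshold_gt0 h) (aliased_prob_le h).
move=> /le_trans; apply.
(* One 1/128 pays for aliasing from [B], through the size of [B], the other for Markov's inequality,
   through the factor 128 in [threshold]. *)
rewrite lee_fin (_ : 64^-1 = 128^-1 + 128^-1 :> R); last by lra.
apply: lerD.
  apply: (@le_trans _ _ (\sum_(k <- (B `\ h)%fset) (N.-1)%:R^-1)).
    rewrite big_seq [leRHS]big_seq; apply: ler_sum => k; rewrite !inE => /andP[kh kB].
    rewrite /alias_prob ifN//; apply: contra kh => ch; apply/eqP; apply: distinct => //.
    exact: (fsubsetP BA).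
  rewrite big_const_seq count_predT iter_addr_0 -[leLHS]mulr_natl ler_pdivrMr//.
  rewrite ler_pdivlMl// -natrM ler_nat; apply: leq_trans cardB.
  by rewrite leq_mul2l fsubset_leq_card ?orbT// fsubD1set.
rewrite -/(mean_err h) mulrC ler_pdivrMr ?threshold_gt0// ler_pdivlMl//.
by rewrite lerDl sqr_ge0.
Qed.

(** After exchanging the sums, each frequency outside [B] is charged at most twice its mass. *)
Lemma sum_mean_err : \sum_(h <- A) mean_err h <= 2 * V.
Proof.
apply: (@le_trans _ _ (\sum_(h <- A) \sum_(k <- ((K0 `|` A) `\` B)%fset)
    alias_prob h k * normc (fhat k) ^+ 2)).
  apply: ler_sum => h _; rewrite /mean_err [leRHS](@big_fsetU_diff _ _ (far h)).
    by rewrite lerDl; apply: sumr_ge0 => k _; rewrite mulr_ge0 ?alias_prob_ge0 ?sqr_ge0.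
  exact: fsubD1set.
rewrite exchange_big /=.
apply: (@le_trans _ _ (\sum_(k <- ((K0 `|` A) `\` B)%fset) 2 * normc (fhat k) ^+ 2)).
  apply: ler_sum => k _; rewrite -mulr_suml ler_wpM2r ?sqr_ge0//.
  exact: sum_alias_prob_le.
by rewrite -mulr_sumr ler_pM2l//; exact: tailV.
Qed.

(** In the aliasing sum the term of h is exactly [fourier f h], the other terms from [B] vanish, and
    those of [far h] stay below the threshold. *)
Lemma not_bad_close h z D : h \in A -> ~ bad h (z, D) ->
  normc (lattice_coef N f (z, D) h - fhat h) <= Num.sqrt (threshold h) + eps.
Proof.
move=> hA nb.
have nB k : k \in B -> k != h -> ~~ aliased N h k z.
  move=> kB kh; apply/negP => al; apply: nb; left; exists k => //=.
  by rewrite !inE kh.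
have small : normc (trigpoly (far h) (alias_coef N h fhat z) D) ^+ 2 < threshold h.
  by rewrite ltNge; apply/negP => H; apply: nb; right.
have [fper _ _ _] := fK.
have hN0 : (0 < N)%N by exact: ltnW N1.
have := lattice_coef_approx hN0 z D h fper (K0approx (fsubsetUl K0 A)).
set L := lattice_coef N f (z, D) h.
pose F k := if (N%:Z %| dotz (subt k h) z)%Z
  then fhat k * cexp2pi (dotp (subt k h) D) else 0.
have -> : \sum_(k <- (K0 `|` A)%fset) F k
   = fhat h + trigpoly (far h) (alias_coef N h fhat z) D * cexp2pi (- dotp h D).
  rewrite (big_fsetD1 h)/=; last by rewrite !inE hA orbT.
  congr (_ + _).
    rewrite /F (_ : dotz _ _ = 0); last first.
      by apply: big1 => j _; rewrite tnth_mktuple subrr mul0r.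
    by rewrite dvdz0 dotp_subt subrr cexp2pi0 mulr1.
  have sub : (far h `<=` (K0 `|` A) `\ h)%fset.
    by apply: fsetSD; exact: fsubsetDl.
  rewrite (big_fsetU_diff _ sub) [X in _ + X]big1_seq ?addr0; last first.
    move=> k; rewrite /= /far !inE => /andP[H1 /andP[kh kKA]].
    have kB : k \in B by move: H1; rewrite kh kKA andbT; case: (k \in B).
    by rewrite /F ifN//; exact: nB.
  rewrite /trigpoly mulr_suml; apply: eq_bigr => k _.
  rewrite /F /alias_coef /aliased; case: ifP => _; last by rewrite !mul0r.
  by rewrite dotp_subt cexp2piD mulrA.
set S := trigpoly _ _ _ * _ => LS.
have hS : normc S <= Num.sqrt (threshold h).
  rewrite Normc.normcM normc_cexp2pi mulr1 -[leLHS]ger0_norm ?normc_ge0// -sqrtr_sqr.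
  by rewrite ler_wsqrtr// ltW.
rewrite (_ : L - fhat h = S + (L - (fhat h + S))); last by ring.
by apply: le_trans (le_normcD _ _) _; apply: lerD.
Qed.

Lemma core_deterministic (w : m.-tuple (d.-tuple nat * d.-tuple (measurableTypeR R))) :
  (forall h, h \in A -> ~ (n.+1 <= failures (bad h) w)%N) ->
  (L2norm (fun x => (f x - \sum_(h <- A) median_coef N f w h * cexp2pi (dotp h x))%R) ^+ 2
   <= (1026 * V)%:E)%E.
Proof.
move=> hw.
apply: le_trans (@L2norm_sqr_le _ _ _ _ _ fK A (median_coef N f w) V _) _.
  move=> K; apply: le_trans (tailV K).
  rewrite [leRHS](@big_fsetU_diff _ _ (K `\` A)%fset); last exact: fsetDS.
  by rewrite lerDl; apply: sumr_ge0 => k _; rewrite sqr_ge0.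
(* The first V is the mass outside [A], 512 (2 V) bounds 512 times the sum of the [mean_err h], and
   the last V comes from eps. *)
rewrite lee_fin (_ : 1026 * V = V + (512 * (2 * V) + V)); last by ring.
rewrite lerD2l.
apply: (@le_trans _ _ (\sum_(h <- A) (512 * mean_err h + V / N%:R))).
  rewrite big_seq [leRHS]big_seq; apply: ler_sum => h hA.
  apply: (@le_trans _ _ (2 * (Num.sqrt (threshold h) + eps) ^+ 2)).
    apply: cmedian_close; first by rewrite size_map size_tuple /= odd_double.
    rewrite size_map size_tuple /= uphalf_double.
    have : ~~ (n.+1 <= failures (bad h) w)%N by apply/negP; exact: hw.
    rewrite -leqNgt; apply: leq_trans.
    rewrite count_map -sum1_count big_tuple /failures big_mkcond /=.
    apply: leq_sum => r _; case: ifP => // H; case: (boolP (_ \in _)) => //.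
    rewrite notin_setE; case: (tnth w r) H => z D H nb.
    by have := not_bad_close hA nb; rewrite leNgt H.
  have sT : Num.sqrt (threshold h) ^+ 2 = threshold h by rewrite sqr_sqrtr// ltW// threshold_gt0.
  apply: (@le_trans _ _ (4 * threshold h + 4 * eps ^+ 2)).
    move: sT; set a := Num.sqrt _ => <-.
    rewrite -subr_ge0 (_ : _ - _ = 2 * (a - eps) ^+ 2); last by ring.
    by rewrite mulr_ge0// sqr_ge0.
  have N0 : N%:R != 0 :> R by rewrite pnatr_eq0 -lt0n ltnW.
  rewrite /threshold eps2 invfM le_eqVlt; apply/orP; left; apply/eqP.
  by field.
rewrite big_split /= -mulr_sumr; apply: lerD.
  by apply: ler_wpM2l; [exact: ler0n|exact: sum_mean_err].
rewrite big_const_seq count_predT iter_addr_0 -[leLHS]mulr_natl mulrCA ger_pMr//.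
rewrite ler_pdivrMr ?ltr0n ?(ltnW N1)// mul1r ler_nat.
by apply: leq_trans cardA _; exact: leq_pred.
Qed.

End core.

Section core_probability.
Variables (R : realType) (alpha : R) (gamma : nat -> R) (N d n : nat).
Variable f : d.-tuple R -> R[i].
Hypothesis fK : korobov_space alpha gamma f.
Variables (A B : {fset d.-tuple int}) (V : R).
Local Open Scope complex_scope.
Local Notation normc := Normc.normc.
Local Notation fhat := (fourier f).
Local Notation m := n.*2.+1.

Lemma core_probability : prime N -> (B `<=` A)%fset ->
  (#|` A| <= N.-1)%N -> (128 * #|` B| <= N.-1)%N ->
  (forall h h', h \in A -> h' \in A -> congruent N h h' -> h = h') ->
  0 < V ->
  (forall K : {fset d.-tuple int}, \sum_(k <- (K `\` B)%fset) normc (fhat k) ^+ 2 <= V) ->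
  ((1 - (N.-1)%:R * 16^-1 ^+ n.+1)%:E <= draws d N m
    [set w | L2norm (fun x => (f x - \sum_(h <- A) median_coef N f w h * cexp2pi (dotp h x))%R) ^+ 2
       <= (1026 * V)%:E])%E.
Proof.
move=> pN BA cA cB dA V0 tV.
have N0 : (0 < N)%N by exact: prime_gt0.
have e0 : 0 < Num.sqrt (V / (8 * N%:R)) by rewrite sqrtr_gt0 divr_gt0// mulr_gt0// ltr0n.
have [K0 hK0] := korobov_approx fK e0.
pose P1 : probability _ R := (power_prob (uniform_pos N) d \x lebesgue_cube d)%E.
pose U h := [set w : m.-tuple (d.-tuple nat * d.-tuple (measurableTypeR R)) |
   (n.+1 <= failures (bad N f A B V K0 h) w)%N].
have mbad h : measurable (bad N f A B V K0 h) by exact: measurable_bad_set.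
(* The event that every frequency of [A] has at most n bad draws is measurable and contained in the
   event in question. *)
apply: (@le_trans _ _ (draws d N m [set w | forall h, h \in A -> ~ U h w])); last first.
  by apply: mono_draws => w hw; exact: (core_deterministic fK pN BA cA dA V0 tV hK0 hw).
apply: le_trans (@probability_setC_bigU_ge _ _ _ (draws d N m) _ A U (16^-1 ^+ n.+1) _ _).
- rewrite lee_fin lerD2l lerN2 ler_wpM2r ?exprn_ge0 ?invr_ge0//.
  by rewrite ler_nat.
- by move=> h hA; exact: measurable_failures.
- move=> h hA.
  apply: le_trans (@power_prob_failures _ _ _ P1 (bad N f A B V K0 h) 64^-1 (mbad h) _ _ m n.+1) _.
  + by [].
  + exact: bad_le.
  rewrite lee_fin.
  (* The factor 4^-(n+1) outweighs the binomial coefficient, which is at most 2^(2n+1). *)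
  rewrite (_ : 64^-1 = 4^-1 * 16^-1 :> R); last by lra.
  rewrite exprMn mulrA ger_pMl ?exprn_gt0// exprVn ler_pdivrMr ?exprn_gt0// mul1r.
  rewrite -natrX ler_nat; apply: leq_trans (bin_le_exp2 _ _) _.
  by rewrite (_ : 4 = 2 ^ 2)%N// -expnM leq_exp2l// mul2n doubleS leqnSn.
Qed.

End core_probability.

(** * The error bound in terms of N_star *)

Section korobov_whp.
Variables (R : realType) (alpha : R) (gamma : nat -> R).
Hypothesis alpha_gt : 2^-1 < alpha.
Hypothesis gamma_gt0 : forall j, 0 < gamma j.
Hypothesis gamma_le1 : forall j, gamma j <= 1.
Local Open Scope complex_scope.
Local Notation normc := Normc.normc.
Local Notation gam j := (gamma j `^ (2 * alpha)^-1).

Let a2_gt0 : 0 < 2 * alpha.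
Proof. by rewrite mulr_gt0// (lt_trans _ alpha_gt). Qed.

Lemma prod_ge1 I (s : seq I) (F : I -> R) : (forall i, 1 <= F i) -> 1 <= \prod_(i <- s) F i.
Proof.
move=> F1; elim/big_ind: _ => // x y x1 y1.
by rewrite -[1]mulr1 ler_pM.
Qed.

Lemma prod_ge_factor (d : nat) (F : 'I_d -> R) (j : 'I_d) : (forall i, 1 <= F i) ->
  F j <= \prod_(i < d) F i.
Proof.
move=> F1; rewrite (bigD1 j)//= ler_peMr ?(le_trans _ (F1 j))//.
rewrite big_mkcond; apply: prod_ge1 => i; by case: ifP.
Qed.

(** All factors of the weight are at least 1, so the j-th one alone obeys the bound; then take the
    root of order 2 alpha. *)
Lemma index_coord_le d (L : R) (h : d.-tuple int) (j : 'I_d) : 0 < L ->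
  korobov_weight alpha gamma h <= L `^ (2 * alpha) ->
  `|(tnth h j)%:~R : R| <= gam j * L.
Proof.
move=> L0 hL.
have hj : `|(tnth h j)%:~R : R| `^ (2 * alpha) / gamma j <= L `^ (2 * alpha).
  apply: le_trans hL; apply: le_trans (prod_ge_factor (F := fun j : 'I_d =>
    Num.max (`|(tnth h j)%:~R : R| `^ (2 * alpha) / gamma j) 1) j _).
    by rewrite le_max lexx.
  by move=> i; exact: korobov_factor_ge1.
rewrite leNgt; apply/negP => lt.
have := gt0_ltr_powR a2_gt0 _ _ lt; rewrite !nnegrE normr_ge0 mulr_ge0 ?powR_ge0 ?(ltW L0)//.
move=> /(_ isT isT); rewrite powRM ?powR_ge0 ?(ltW L0)// -powRrM mulVf ?gt_eqF//.
rewrite powRr1 ?(ltW (gamma_gt0 j))// ltNge => /negP; apply.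
by rewrite -ler_pdivrMl// mulrC.
Qed.

Variables (N d : nat) (tau : R).
Hypothesis pN : prime N.
Hypothesis tau_gt0 : 0 < tau.
Local Notation NS := (N_star alpha gamma d N tau).
Local Notation PN := (P_N alpha gamma d N tau).

Let N1 : (1 < N)%N. Proof. exact: prime_gt1. Qed.

Let Npred : (N.-1)%:R = N%:R - 1 :> R.
Proof. by rewrite -subn1 natrB// ltnW. Qed.

Let tln0 : 0 <= tau * ln (N%:R : R).
Proof. by rewrite mulr_ge0 ?(ltW tau_gt0)// ln_ge0// ler1n ltnW. Qed.

Lemma PN_factor_ge1 (j : nat) : 1 <= 1 + 2 * gam j * (1 + tau * ln N%:R).
Proof. by rewrite lerDl !mulr_ge0 ?powR_ge0// addr_ge0. Qed.

Lemma P_N_ge1 : 1 <= PN.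
Proof. by apply: prod_ge1 => j; exact: PN_factor_ge1. Qed.

Let EP_ge1 : 1 <= expR tau^-1 * PN.
Proof.
rewrite -[1]mulr1 ler_pM ?P_N_ge1//.
by rewrite -expR0 ler_expR invr_ge0 ltW.
Qed.

Let EP_gt0 : 0 < expR tau^-1 * PN. Proof. by rewrite (lt_le_trans _ EP_ge1). Qed.

Lemma N_star_gt0 : 0 < NS.
Proof. by rewrite /N_star divr_gt0// -Npred ltr0n -subn1 subn_gt0. Qed.

Lemma N_star_le : NS <= N%:R.
Proof.
rewrite /N_star ler_pdivrMr//; apply: (@le_trans _ _ N%:R); first by rewrite gerBl.
by rewrite ler_peMr.
Qed.

(** An infinite index set would have finite subsets exceeding the bound of [card_index_le]. *)
Lemma finite_A_index (L : R) : 0 < L <= N%:R -> finite_set (A_index (d := d) alpha gamma L).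
Proof.
move=> hL; apply: contrapT => inf.
have [C CA cC] := infinite_set_fset (Num.truncn (L * (expR tau^-1 * PN))).+1 inf.
have := @card_index_le R alpha gamma alpha_gt gamma_gt0 gamma_le1 d N tau L C N1 tau_gt0 hL (fun h hC => CA h hC).
rewrite leNgt => /negP; apply; rewrite -truncn_lt_nat//.
by rewrite mulr_ge0 ?(ltW EP_gt0)//; case/andP: hL => /ltW.
Qed.

Definition A_fset (L : R) : {fset d.-tuple int} := fset_set (A_index (d := d) alpha gamma L).

Lemma in_A_fset L h : 0 < L <= N%:R ->
  (h \in A_fset L) = (korobov_weight alpha gamma h <= L `^ (2 * alpha)).
Proof.
move=> hL; rewrite /A_fset in_fset_set; last exact: finite_A_index.
by apply/idP/idP; rewrite inE.
Qed.

Lemma card_A_fset L : 0 < L <= N%:R -> (#|` A_fset L|)%:R <= L * (expR tau^-1 * PN).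
Proof.
move=> hL; apply: card_index_le => // h; by rewrite in_A_fset.
Qed.

Let NS_bounds : 0 < NS <= N%:R. Proof. by rewrite N_star_gt0 N_star_le. Qed.

Let NSc_bounds : 0 < NS / 128 <= N%:R.
Proof.
rewrite divr_gt0 ?N_star_gt0//=; apply: le_trans N_star_le.
by rewrite ler_pdivrMr// ler_peMr ?(ltW N_star_gt0)// ler1n.
Qed.

Lemma card_A : (#|` A_fset NS| <= N.-1)%N.
Proof.
rewrite -(@ler_nat R) Npred; apply: le_trans (card_A_fset NS_bounds) _.
by rewrite /N_star divfK// gt_eqF.
Qed.

(** The cardinality bound is linear in the level, so dividing the level by 128 divides it too. *)
Lemma card_B : (128 * #|` A_fset (NS / 128)| <= N.-1)%N.
Proof.
rewrite -(@ler_nat R) Npred natrM -ler_pdivlMl//; apply: le_trans (card_A_fset NSc_bounds) _.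
by rewrite mulrAC /N_star divfK ?gt_eqF// mulrC.
Qed.

Lemma sub_BA : (A_fset (NS / 128) `<=` A_fset NS)%fset.
Proof.
apply/fsubsetP => h.
rewrite (in_A_fset _ NSc_bounds) (in_A_fset _ NS_bounds) => /le_trans; apply.
apply: ge0_ler_powR; rewrite ?(ltW a2_gt0) ?nnegrE ?(ltW N_star_gt0)//.
  by case/andP: NSc_bounds => /ltW.
by rewrite ler_pdivrMr// ler_peMr ?(ltW N_star_gt0)// ler1n.
Qed.

(** Distinct congruent frequencies differ by at least N in some coordinate j, whereas index bounds
    and 2 gamma_j^(1/(2 alpha)) <= P_N keep the difference at most N - 1. *)
Lemma A_fset_distinct h h' : h \in A_fset NS -> h' \in A_fset NS ->
  congruent N h h' -> h = h'.
Proof.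
rewrite !in_A_fset// => hh hh' /forallP c; apply: eq_from_tnth => j.
have hj := index_coord_le j N_star_gt0 hh; have hj' := index_coord_le j N_star_gt0 hh'.
have := c j; rewrite tnth_mktuple => dv.
apply/eqP; rewrite -subr_eq0; apply/negPn/negP => n0.
have : N%:R <= `|(tnth h j - tnth h' j)%:~R : R|.
  rewrite -intr_norm -natr_absz ler_nat dvdn_leq ?absz_gt0//.
rewrite leNgt => /negP; apply.
rewrite intrB; apply: le_lt_trans (ler_normB _ _) _.
apply: le_lt_trans (lerD hj hj') _.
rewrite -mulr2n -[X in X < _]mulr_natl mulrA.
have gP : 2 * gam j <= expR tau^-1 * PN.
  apply: (@le_trans _ _ PN); last first.
    by rewrite ler_peMl ?(le_trans _ P_N_ge1)// -expR0 ler_expR invr_ge0 ltW.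
  apply: le_trans (prod_ge_factor (F := fun j : 'I_d => 1 + 2 * gam j * (1 + tau * ln N%:R)) j _).
    apply: (@le_trans _ _ (2 * gam j * (1 + tau * ln N%:R))).
      by rewrite ler_peMr ?mulr_ge0 ?powR_ge0// lerDl.
    by rewrite lerDr.
  by move=> i; exact: PN_factor_ge1.
rewrite /N_star mulrCA -mulrC; apply: (@le_lt_trans _ _ (N%:R - 1)).
  rewrite mulrC ler_piMr//; first by rewrite -Npred.
  by rewrite ler_pdivrMr// mul1r.
by rewrite gtrBl.
Qed.

Variable f : d.-tuple R -> R[i].
Hypothesis fK : korobov_space alpha gamma f.
Local Notation fhat := (fourier f).

Let norm_fin : (korobov_norm2 alpha gamma f < +oo)%E. Proof. by case: fK. Qed.

Let term_ge0 (h : d.-tuple int) : 0 <= normc (fhat h) ^+ 2 * korobov_weight alpha gamma h.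
Proof.
by rewrite mulr_ge0 ?sqr_ge0// (le_trans _ (korobov_weight_ge1 _ _ h)).
Qed.

Lemma korobov_norm_sqr : korobov_norm alpha gamma f ^+ 2 = fine (korobov_norm2 alpha gamma f).
Proof.
by rewrite sqr_sqrtr// fine_ge0// esum_ge0// => h _; rewrite lee_fin.
Qed.

Lemma sum_le_korobov_norm (K : {fset d.-tuple int}) :
  \sum_(h <- K) normc (fhat h) ^+ 2 * korobov_weight alpha gamma h
  <= korobov_norm alpha gamma f ^+ 2.
Proof. by rewrite korobov_norm_sqr; exact: (fset_sum_le term_ge0 norm_fin). Qed.

(** Outside the index set the Korobov weight exceeds L^(2 alpha). *)
Lemma korobov_tail (L : R) (K : {fset d.-tuple int}) : 0 < L <= N%:R ->
  \sum_(k <- (K `\` A_fset L)%fset) normc (fhat k) ^+ 2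
  <= korobov_norm alpha gamma f ^+ 2 / L `^ (2 * alpha).
Proof.
move=> hL; have /andP[L0 _] := hL.
rewrite ler_pdivlMr ?powR_gt0//; apply: le_trans (sum_le_korobov_norm (K `\` A_fset L)%fset).
rewrite mulr_suml big_seq [leRHS]big_seq; apply: ler_sum => k.
rewrite inE in_A_fset// -ltNge => /andP[kL _].
by rewrite ler_wpM2l ?sqr_ge0// ltW.
Qed.

Lemma A_randE m (w : m.-tuple (d.-tuple nat * d.-tuple R)) x :
  A_rand alpha gamma N tau f w x
  = \sum_(h <- A_fset NS) median_coef N f w h * cexp2pi (dotp h x).
Proof. by rewrite /A_rand fsbig_finite//; exact: finite_A_index. Qed.

Lemma korobov_norm0 : korobov_norm alpha gamma f ^+ 2 = 0 -> forall x, f x = 0.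
Proof.
move=> n0.
have f0 h : fhat h = 0.
  have := sum_le_korobov_norm [fset h]%fset; rewrite n0 big_seq_fset1 => H.
  have : normc (fhat h) ^+ 2 * korobov_weight alpha gamma h == 0.
    by rewrite eq_le H term_ge0.
  rewrite mulf_eq0 sqrf_eq0 => /orP[/eqP/Normc.eq0_normc//|].
  by rewrite gt_eqF// (lt_le_trans _ (korobov_weight_ge1 _ _ h)).
move=> x; have [_ _ hs _] := fK; have {}hs := hs x.
apply: Normc.eq0_normc; apply/eqP; rewrite eq_le normc_ge0 andbT.
apply/ler_addgt0Pr => e e0; rewrite add0r.
have [A0 hA0] := hs e e0; have := hA0 A0 (fsubset_refl _).
rewrite big1 ?sub0r ?normcN; first exact: ltW.
by move=> i _; rewrite f0 mul0r.
Qed.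

Lemma error_bound_whp_le m delta (V V' : R) : V <= V' ->
  error_bound_whp alpha gamma N m tau delta f V ->
  error_bound_whp alpha gamma N m tau delta f V'.
Proof.
move=> VV' H; apply: le_trans H _; apply: mono_draws => w /= /le_trans; apply.
by rewrite lee_fin.
Qed.

Lemma korobov_error_bound_whp n delta : 0 <= delta ->
  (N.-1)%:R * 16^-1 ^+ n.+1 <= delta ->
  error_bound_whp alpha gamma N n.*2.+1 tau delta f
    (1026 * 128 `^ (2 * alpha) * (korobov_norm alpha gamma f ^+ 2 / NS `^ (2 * alpha))).
Proof.
move=> d0 hd.
pose V := korobov_norm alpha gamma f ^+ 2 / (NS / 128) `^ (2 * alpha).
have VE : 1026 * 128 `^ (2 * alpha) * (korobov_norm alpha gamma f ^+ 2 / NS `^ (2 * alpha)) = 1026 * V.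
  rewrite /V powRM ?(ltW N_star_gt0) ?invr_ge0// -[128^-1]powR_inv1// -powRrM mulN1r powRN.
  by rewrite invfM invrK; ring.
rewrite VE /error_bound_whp.
have E (w : n.*2.+1.-tuple (d.-tuple nat * d.-tuple R)) :
   (fun x => f x - A_rand alpha gamma N tau f w x)
   = (fun x => f x - \sum_(h <- A_fset NS) median_coef N f w h * cexp2pi (dotp h x)).
  by apply/funext => x; rewrite A_randE.
(* [core_probability] requires V > 0. If the norm is zero then f = 0, all computed coefficients
   vanish and the error is zero for every draw. *)
have [n0|n0] := eqVneq (korobov_norm alpha gamma f ^+ 2) 0.
  have f0 := korobov_norm0 n0.
  rewrite (_ : [set w | _] = setT).
    by rewrite probability_setT lee_fin gerBl.
  apply/seteqP; split => // w _ /=; rewrite E /V n0 mul0r mulr0.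
  apply: le_trans (@L2norm_sqr_le _ _ _ _ _ fK (A_fset NS) (median_coef N f w) 0 _) _.
    move=> K; apply: le_trans (korobov_tail K NS_bounds) _.
    by rewrite n0 mul0r.
  rewrite lee_fin add0r big1// => h _.
  have fh0 : fhat h = 0.
    rewrite /fourier /cintegral.
    under eq_Rintegral do rewrite f0 mul0r.
    under [X in _ +i* X]eq_Rintegral do rewrite f0 mul0r.
    by rewrite /= /Rintegral !integral0.
  apply/eqP; rewrite eq_le sqr_ge0 andbT.
  apply: (@le_trans _ _ (2 * 0 ^+ 2)); last by rewrite expr0n mulr0.
  apply: cmedian_close; first by rewrite size_map size_tuple /= odd_double.
  rewrite (@eq_in_count _ _ pred0); first by rewrite count_pred0.
  move=> z /mapP[zD _ ->].
  rewrite fh0 subr0 /lattice_coef big1 ?mulr0 ?Normc.normc0 ?ltxx// => k _.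
  by rewrite f0 mul0r.
have V0 : 0 < V.
  apply: divr_gt0; first by rewrite lt_def n0 sqr_ge0.
  by apply: powR_gt0; case/andP: NSc_bounds.
have := @core_probability R alpha gamma N d n f fK (A_fset NS) (A_fset (NS / 128)) V
  pN sub_BA card_A card_B A_fset_distinct V0 (fun K => korobov_tail K NSc_bounds).
set S1 := [set w | _]; set S2 := [set w | _] => H.
apply: (@le_trans _ _ (1 - (N.-1)%:R * 16^-1 ^+ n.+1)%:E).
  by rewrite lee_fin lerD2l lerN2.
apply: (le_trans H); apply: mono_draws => w; rewrite /S1 /S2 /mkset E.
exact.
Qed.

End korobov_whp.

(** * Choice of the parameters *)

Section parameters.
Variable R : realType.

Lemma expR1_le4 : expR 1 <= 4 :> R.
Proof.
have h : (2^-1 : R) <= expR (- 2^-1).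
  by apply: le_trans (expR_ge1Dx _); lra.
have e2 : expR (2^-1 : R) <= 2.
  by rewrite -[leRHS]invrK -[leLHS]invrK lef_pV2 ?posrE ?invr_gt0 ?expR_gt0// -expRN.
have -> : (1 : R) = 2^-1 + 2^-1 by lra.
rewrite expRD; have := ler_pM (expR_ge0 _) (expR_ge0 _) e2 e2; lra.
Qed.

(** The base of the second power in [C_N]; any R below it has its power R^(2 alpha) absorbed by
    [C_N]. *)
Definition repetition_bound (delta : R) (N : nat) : R :=
  2 * ln (1 + (N%:R - 1) / (4 * expR 1)) + 2 * ln delta^-1 + 1.

Lemma repetitions_exist (delta : R) (N : nat) : 0 < delta < 1 -> (1024 < N)%N ->
  exists n : nat, [/\ (n.*2.+1)%:R <= repetition_bound delta N,
    ln N%:R <= (n.*2.+1)%:R :> R,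
    (n.*2.+1)%:R <= (3 + 2 * ln delta^-1) * ln N%:R :> R &
    (N.-1)%:R * 16^-1 ^+ n.+1 <= delta].
Proof.
move=> /andP[d0 d1] hN.
have N1 : 1 <= N%:R :> R by rewrite ler1n; lia.
have hN' : 1024 < N%:R :> R by rewrite ltr_nat.
have predN : (N.-1)%:R = N%:R - 1 :> R by rewrite -subn1 natrB//; lia.
have e0 := expR_gt0 (1 : R); have e4 := expR1_le4.
have e1 : 1 <= expR 1 :> R by rewrite -expR0 ler_expR.
pose u : R := 1 + (N%:R - 1) / (4 * expR 1).
have u_ge : 1 + (N%:R - 1) / 16 <= u.
  rewrite lerD2l ler_wpM2l ?subr_ge0// lef_pV2 ?posrE ?mulr_gt0//; lra.
have u_le : u <= N%:R.
  rewrite /u -lerBrDl ler_piMr ?subr_ge0// invf_le1 ?mulr_gt0//; lra.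
have u1 : 1 <= u by lra.
have u0 : 0 < u by lra.
(* Here N > 1024 enters: (N / 16)^2 >= 4 N. *)
have u2 : 4 * N%:R <= u ^+ 2.
  have : N%:R / 16 <= u by lra.
  rewrite expr2; nra.
have lnu0 : 0 <= ln u by rewrite ln_ge0.
have lnd0 : 0 <= ln delta^-1 by rewrite ln_ge0// invf_ge1// ltW.
pose Q := repetition_bound delta N.
have QE : Q = 2 * ln u + 2 * ln delta^-1 + 1 by [].
pose x := (Q - 1) / 2.
have xE : x = ln u + ln delta^-1 by rewrite /x QE; lra.
have x0 : 0 <= x by rewrite xE addr_ge0.
(* With x = ln (u / delta), 2 n + 1 is the largest odd number not above 2 x + 1 = Q. *)
pose n := Num.truncn x; exists n.
have /andP[nx xn] := truncn_itv x0.
have mE : (n.*2.+1)%:R = 2 * n%:R + 1 :> R by rewrite -natr1 -mul2n natrM.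
have ln4 : ln (4 : R) >= 1 by rewrite -[leLHS]expRK ler_ln ?posrE.
have lnN : 1 <= ln N%:R :> R.
  by apply: le_trans ln4 _; rewrite ler_ln ?posrE; lra.
have lnuN : ln u <= ln N%:R by rewrite ler_ln ?posrE; lra.
rewrite -/n in nx xn.
split.
- by rewrite -/Q mE; rewrite /x in nx; lra.
- have : 1 + ln N%:R <= 2 * ln u.
    rewrite mulr_natl -lnXn//.
    apply: le_trans (_ : ln (4 * N%:R) <= _); last by rewrite ler_ln ?posrE ?mulr_gt0//; lra.
    by rewrite lnM ?posrE//; lra.
  by rewrite mE; move: xn; rewrite xE -natr1 -/n; lra.
- rewrite mE; apply: (@le_trans _ _ Q); first by rewrite /x in nx; lra.
  rewrite QE; nra.
- apply: (@le_trans _ _ ((N%:R - 1) * (delta / u) ^+ 2)).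
    rewrite predN ler_wpM2l ?subr_ge0//.
    rewrite (_ : 16^-1 = 4^-1 ^+ 2); last by rewrite exprVn; congr (_^-1); ring.
    rewrite -exprM mulnC exprM ler_pXn2r ?nnegrE ?exprn_ge0 ?divr_ge0 ?(ltW d0) ?(ltW u0)//.
    have -> : delta / u = expR (- x).
      by rewrite xE opprD expRD !expRN !lnK ?posrE ?invr_gt0// invrK mulrC.
    (* As e <= 4 and n + 1 > x, 4^-(n+1) <= exp(-(n+1)) <= exp(-x) = delta / u. *)
    apply: (@le_trans _ _ (expR (- 1) ^+ n.+1)).
      by rewrite ler_pXn2r ?nnegrE ?invr_ge0 ?expR_ge0// expRN lef_pV2 ?posrE.
    rewrite -expRM_natl mulrN1 ler_expR lerN2 ltW//.
  rewrite expr_div_n mulrA ler_pdivrMr ?exprn_gt0//.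
  have h : (N%:R - 1) * delta <= u ^+ 2.
    apply: (@le_trans _ _ (N%:R - 1)); first by rewrite ler_piMr ?subr_ge0// ltW.
    lra.
  by have := ler_wpM2l (ltW d0) h; rewrite mulrCA -expr2.
Qed.

End parameters.

(** * Comparison of the bound in N_star with the bounds of the theorem *)

Section bounds.
Variables (R : realType) (alpha : R) (gamma : nat -> R) (delta eta : R).
Hypothesis alpha_gt : 2^-1 < alpha.
Hypothesis gamma_gt0 : forall j, 0 < gamma j.
Hypothesis gamma_le1 : forall j, gamma j <= 1.
Hypothesis eta01 : 0 < eta < 1.
Local Notation gam j := (gamma j `^ (2 * alpha)^-1).
Local Notation G d := (G_sum alpha gamma d).

Let a2_gt0 : 0 < 2 * alpha.
Proof. by rewrite mulr_gt0// (lt_trans _ alpha_gt). Qed.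

Let eta0 : 0 < eta. Proof. by case/andP: eta01. Qed.

(* The factor ln (N - 1) hidden in [C_N] absorbs any constant K once N is large. *)
Lemma C_N_ge (K t : R) (N m : nat) : 0 <= K -> 0 <= t -> (1024 < N)%N -> (0 < m)%N ->
  m%:R <= repetition_bound delta N -> K <= ln (N%:R - 1) ->
  K / (N%:R - 1) `^ (2 * alpha)
  <= C_N alpha delta N t / (m * N)%:R `^ (2 * alpha).
Proof.
move=> K0 t0 N1 m0 mQ KN.
have hN : 1024 < N%:R :> R by rewrite ltr_nat.
have mr : 0 < m%:R :> R by rewrite ltr0n.
have Q0 : 0 < repetition_bound delta N by apply: lt_le_trans mQ.
rewrite /C_N -/(repetition_bound delta N).
set Q := repetition_bound delta N in mQ Q0 *.
set n := N%:R in KN hN *.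
have n10 : 0 < n - 1 by lra.
have n0 : 0 < n by lra.
have last_ge : K <= 2 * t^-1 + 1 + 2 * n / (n - 1) * ln (n - 1).
  apply: (@le_trans _ _ (ln (n - 1))) => //.
  have l0 : 0 <= ln (n - 1) by apply: le_trans KN.
  have t1 : 0 <= t^-1 by rewrite invr_ge0.
  have : ln (n - 1) <= 2 * n / (n - 1) * ln (n - 1).
    by rewrite ler_peMl// ler_pdivlMr// mul1r; lra.
  lra.
set l := 2 * t^-1 + _ + _ in last_ge *.
rewrite natrM -/n [(m%:R * n) `^ _]powRM ?(ltW mr) ?(ltW n0)//.
rewrite [n / (n - 1)]mulrC powRM ?invr_ge0 ?(ltW n10) ?(ltW n0)//.
rewrite -[(n - 1)^-1]powR_inv1 ?(ltW n10)// -powRrM mulN1r powRN.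
set a := n `^ _; set b := (n - 1) `^ _; set c := m%:R `^ _; set q := Q `^ _.
have a0 : 0 < a by exact: powR_gt0.
have b0 : 0 < b by exact: powR_gt0.
have c0 : 0 < c by exact: powR_gt0.
have cq : c <= q by rewrite ge0_ler_powR ?nnegrE ?(ltW a2_gt0) ?(ltW mr) ?(ltW Q0).
have -> : b^-1 * a * q * l / (c * a) = (q / c * l) / b.
  by field; rewrite !gt_eqF.
rewrite ler_wpM2r ?invr_ge0 ?(ltW b0)//; apply: (le_trans last_ge).
by rewrite ler_peMl ?(le_trans K0)// ler_pdivlMr// mul1r.
Qed.

Lemma G_sum_gt0 d : (0 < d)%N -> 0 < G d.
Proof.
case: d => // d _; rewrite /G_sum big_ord_recl mulr_gt0// ltr_pwDl ?powR_gt0//.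
by apply: sumr_ge0 => j _; exact: powR_ge0.
Qed.

(** Bounding each factor of [P_N] by 1 + x <= exp(x) gives exp(G (1 + tau ln N)). For tau = eta / G
    this is exp(G) N^eta, and exp(1 / tau) = exp(G / eta). *)
Lemma expR_P_N_le d (N : nat) : (0 < d)%N -> (0 < N)%N ->
  expR (eta / G d)^-1 * P_N alpha gamma d N (eta / G d)
  <= expR ((eta^-1 + 1) * G d) * N%:R `^ eta.
Proof.
move=> d0 N0; have Gd0 := G_sum_gt0 d0.
have -> : expR ((eta^-1 + 1) * G d) * N%:R `^ eta
   = expR (eta / G d)^-1 * expR (G d * (1 + eta / G d * ln N%:R)).
  rewrite /powR gt_eqF ?ltr0n// -!expRD; congr expR.
  by field; rewrite !gt_eqF.
rewrite ler_pM2l ?expR_gt0// /P_N.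
set y := 1 + eta / G d * ln N%:R.
have y0 : 0 <= y.
  rewrite /y addr_ge0// mulr_ge0// ?divr_ge0 ?(ltW eta0) ?(ltW Gd0)//.
  by rewrite ln_ge0// ler1n.
rewrite /G_sum mulr_sumr mulr_suml expR_sum.
apply: ler_prod => j _; apply/andP; split.
  by rewrite addr_ge0 ?mulr_ge0 ?powR_ge0//.
exact: expR_ge1Dx.
Qed.

(* For d = 1 the factor d^(2 alpha D (1 / eta + 1)) of the second bound is 1, but
   then [P_N] is only logarithmic in N and N^eta alone suffices. *)
Lemma expR_P_N_le1 (N : nat) : (1 < N)%N -> 6 * expR (2 / eta) <= eta * ln N%:R ->
  expR (eta / G 1)^-1 * P_N alpha gamma 1 N (eta / G 1) <= N%:R `^ eta.
Proof.
move=> N1 hN; have G0 := G_sum_gt0 (ltn0Sn 0).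
have gE : G 1 = 2 * gam 0%N by rewrite /G_sum big_ord1.
have g1 : gam 0%N <= 1.
  rewrite -[leRHS](powR_one (2 * alpha)^-1).
  by rewrite ge0_ler_powR ?nnegrE ?invr_ge0 ?(ltW a2_gt0) ?(ltW (gamma_gt0 0)).
rewrite /P_N big_ord1 -gE.
have -> : N%:R `^ eta = expR (eta * ln N%:R) by rewrite /powR gt_eqF ?ltr0n ?(ltnW N1).
rewrite invf_div.
have -> : 1 + G 1 * (1 + eta / G 1 * ln N%:R) = 1 + G 1 + eta * ln N%:R.
  by field; rewrite gt_eqF.
set y := eta * ln N%:R in hN *.
have e1 : expR (G 1 / eta) <= expR (2 / eta).
  by rewrite ler_expR ler_pM2r ?invr_gt0// gE; lra.
have E1 : 1 <= expR (2 / eta) by rewrite -expR0 ler_expR divr_ge0// ltW.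
have E0 := expR_ge0 (G 1 / eta).
have y0 : 0 <= y by lra.
(* The bound 1 + G + y <= 3 (1 + y / 2) uses G <= 2; then 3 exp(2 / eta) <= y / 2 by the size of N,
   and 1 + y / 2 <= exp(y / 2) is applied twice. *)
apply: (@le_trans _ _ (expR (2 / eta) * (3 * (1 + y / 2)))).
  by apply: ler_pM => //; rewrite gE in G0 *; lra.
have -> : expR y = expR (y / 2) * expR (y / 2) by rewrite -expRD; congr expR; lra.
have h := expR_ge1Dx (y / 2).
apply: (@le_trans _ _ ((1 + y / 2) * (1 + y / 2))).
  by rewrite mulrA ler_wpM2r//; lra.
by apply: ler_pM => //; lra.
Qed.

(** Shared by both statements: [Y] bounds the part of exp(1 / tau) P_N that remains beside N^eta,
    and [X] is the resulting factor of the error bound. *)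
Lemma rhs_ge (F K t Y X : R) (N d m : nat) : 0 <= F -> 0 <= K -> 0 <= t ->
  (1024 < N)%N -> (0 < m)%N -> m%:R <= repetition_bound delta N ->
  K <= ln (N%:R - 1) -> 0 <= Y -> X = Y `^ (2 * alpha) ->
  expR (eta / G d)^-1 * P_N alpha gamma d N (eta / G d) <= Y * N%:R `^ eta ->
  K * (F / N_star alpha gamma d N (eta / G d) `^ (2 * alpha))
  <= F * (C_N alpha delta N t / (m * N)%:R `^ (2 * alpha)) * X * N%:R `^ (2 * alpha * eta).
Proof.
move=> F0 K0 t0 N1 m0 mQ KN Y0 -> hY.
have hN : 1024 < N%:R :> R by rewrite ltr_nat.
have n10 : 0 < N%:R - 1 :> R by lra.
have Ge0 : 0 <= G d by rewrite mulr_ge0// sumr_ge0// => j _; exact: powR_ge0.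
have P0 : 0 <= P_N alpha gamma d N (eta / G d).
  apply: prodr_ge0 => j _; rewrite addr_ge0// mulr_ge0// ?mulr_ge0 ?powR_ge0//.
  rewrite addr_ge0// mulr_ge0// ?divr_ge0 ?(ltW eta0)//.
  by rewrite ln_ge0// ltW// (lt_trans _ hN)// ltr1n.
set E := expR _ * _ in hY.
have E0 : 0 <= E by rewrite mulr_ge0 ?expR_ge0.
have NSE : (N_star alpha gamma d N (eta / G d) `^ (2 * alpha))^-1
    = E `^ (2 * alpha) / (N%:R - 1) `^ (2 * alpha).
  rewrite /N_star -/E powRM ?invr_ge0 ?(ltW n10)//.
  rewrite -[E^-1]powR_inv1// -powRrM mulN1r powRN invfM invrK.
  by rewrite mulrC.
rewrite NSE.
have EY : E `^ (2 * alpha) <= Y `^ (2 * alpha) * N%:R `^ (2 * alpha * eta).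
  have -> : N%:R `^ (2 * alpha * eta) = (N%:R `^ eta) `^ (2 * alpha) :> R.
    by rewrite -powRrM mulrC.
  rewrite -powRM ?powR_ge0//.
  by rewrite ge0_ler_powR ?nnegrE ?(ltW a2_gt0)// mulr_ge0// powR_ge0.
have CN := C_N_ge K0 t0 N1 m0 mQ KN.
have b0 : 0 <= K / (N%:R - 1) `^ (2 * alpha) by rewrite divr_ge0 ?powR_ge0.
have := ler_pM b0 (powR_ge0 E (2 * alpha)) CN EY.
move=> /(ler_wpM2l F0).
by set a := E `^ _; set b := _ `^ _; set c := _ `^ _; set e := _ `^ _; set g := _ `^ _;
 rewrite !mulrA => H; apply: le_trans H; rewrite le_eqVlt; apply/orP; left; apply/eqP; ring.
Qed.

End bounds.

(** The limit superior is the infimum of the suprema of the tails, so some tail has a supremum below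
    infinity. *)
Lemma limn_esup_ltyP (R : realType) (u : nat -> R) :
  (limn_esup (fun n => (u n)%:E) < +oo)%E ->
  exists (n0 : nat) (c : R), forall n, (n0 <= n)%N -> u n <= c.
Proof.
rewrite limn_esup_lim (cvg_lim _ (@cvg_esups_inf R (fun n => (u n)%:E)))//.
move=> /ereal_inf_lt[_ [n0 _ <-] hlt]; exists n0; move: hlt.
pose s := esups (fun k => (u k)%:E) n0; rewrite -/s => hlt.
have us n : (n0 <= n)%N -> ((u n)%:E <= s)%E.
  by move=> n0n; rewrite /s /esups/=; apply: ereal_sup_ubound; exists n.
exists (fine s) => n n0n; have := us n n0n.
by case: s hlt {us} => [r| |]//=; rewrite lee_fin.
Qed.

(** * Growth of the partial sums of the weights *)

Section sums_of_weights.
Variables (R : realType) (alpha : R) (gamma : nat -> R).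
Local Notation gam j := (gamma j `^ (2 * alpha)^-1).
Local Notation G d := (G_sum alpha gamma d).

Lemma G_sum_le_infty d : (\sum_(j <oo) (gam j)%:E < +oo)%E -> G d <= G_infty alpha gamma.
Proof.
move=> fin; rewrite /G_sum /G_infty ler_pM2l//.
rewrite -lee_fin fineK; last first.
  by rewrite ge0_fin_numE// nneseries_ge0// => j _ _; rewrite lee_fin powR_ge0.
apply: le_trans (nneseries_lim_ge d _); last by move=> j _ _; rewrite lee_fin powR_ge0.
by rewrite big_mkord sumEFin.
Qed.

Lemma G_sum_le d d' : (d <= d')%N -> G d <= G d'.
Proof.
move=> dd'; rewrite /G_sum ler_pM2l// -!(big_mkord xpredT (fun j => gam j)).
rewrite (big_cat_nat (leq0n d) dd')/= lerDl; apply: sumr_ge0 => j _; exact: powR_ge0.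
Qed.

Lemma G_sum_le_ln :
  (limn_esup (fun d : nat => ((\sum_(j < d) gam j) / ln d%:R)%:E) < +oo)%E ->
  exists D : R, 0 < D /\ forall d, (1 < d)%N -> G d <= D * ln d%:R.
Proof.
move=> /limn_esup_ltyP[n0 [c hc]].
have ln2 : 0 < ln (2 : R) by rewrite ln_gt0// ltr1n.
have G0 d : 0 <= G d by rewrite mulr_ge0// sumr_ge0// => j _; exact: powR_ge0.
(* The first term serves d >= n0, the second serves 1 < d < n0 by monotonicity of [G_sum], and the 1
   makes the constant positive. *)
exists (2 * `|c| + G n0 / ln 2 + 1); split.
  rewrite ltr_wpDl//; apply: addr_ge0; first by rewrite mulr_ge0.
  by rewrite divr_ge0// ltW.
move=> d d1.
have lnd : 0 < ln (d%:R : R) by rewrite ln_gt0// ltr1n.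
have ln2d : ln (2 : R) <= ln d%:R by rewrite ler_ln ?posrE// ?ltr0n ?ler_nat// ltnW.
have c0 := normr_ge0 c; have q0 : 0 <= G n0 / ln 2 by rewrite divr_ge0// ltW.
have [n0d|dn0] := leqP n0 d.
  have := hc d n0d; rewrite ler_pdivrMr// => h.
  apply: (@le_trans _ _ (2 * `|c| * ln d%:R)).
    rewrite /G_sum -mulrA ler_pM2l//; apply: le_trans h _.
    by rewrite ler_wpM2r ?(ltW lnd)// ler_norm.
  by rewrite ler_wpM2r ?(ltW lnd)//; lra.
apply: (@le_trans _ _ (G n0 / ln 2 * ln d%:R)).
  apply: le_trans (G_sum_le (ltnW dn0)) _.
  by rewrite -mulrA ler_peMr// ler_pdivlMl// mulr1.
by rewrite ler_wpM2r ?(ltW lnd)//; lra.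
Qed.

End sums_of_weights.

Theorem theorem13 (R : realType) (alpha : R) (gamma : nat -> R) (delta eta : R) :
  2^-1 < alpha ->
  gamma 0%N <= 1 ->
  (forall j : nat, gamma j.+1 <= gamma j) ->
  (forall j : nat, 0 < gamma j) ->
  0 < delta < 1 ->
  0 < eta < 1 ->
  ((\sum_(j <oo) (gamma j `^ (2 * alpha)^-1)%:E < +oo)%E ->
    exists c1 c2 : R, 0 < c1 /\ 0 < c2 /\
    forall n0 : nat, exists N m : nat,
      [/\ (n0 <= N)%N, prime N, odd m,
          c1 * ln N%:R <= m%:R <= c2 * ln N%:R &
          forall (d : nat) (f : d.-tuple R -> R[i]), (0 < d)%N ->
            korobov_space alpha gamma f ->
            error_bound_whp alpha gamma N m (eta / G_sum alpha gamma d) delta f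
              (korobov_norm alpha gamma f ^+ 2
               * (C_N alpha delta N ((G_infty alpha gamma)^-1 * eta)
                  / (m * N)%:R `^ (2 * alpha))
               * expR (2 * alpha * (eta^-1 + 1) * G_infty alpha gamma)
               * N%:R `^ (2 * alpha * eta))])
  /\
  ((limn_esup (fun d : nat =>
      ((\sum_(j < d) gamma j `^ (2 * alpha)^-1) / ln d%:R)%:E) < +oo)%E ->
    exists D c : R, 0 < D /\ 0 < c /\
    forall n0 : nat, exists (b p : nat) (N m : nat -> nat),
    forall d : nat, (0 < d)%N ->
      [/\ (n0 <= N d <= b * d ^ p)%N, prime (N d), odd (m d),
          (m d)%:R <= c * (ln d%:R + ln (N d)%:R) &
          forall f : d.-tuple R -> R[i],
            korobov_space alpha gamma f ->
            error_bound_whp alpha gamma (N d) (m d) (eta / G_sum alpha gamma d)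
              delta f
              (korobov_norm alpha gamma f ^+ 2
               * (C_N alpha delta (N d) ((G_sum alpha gamma d)^-1 * eta)
                  / (m d * N d)%:R `^ (2 * alpha))
               * d%:R `^ (2 * alpha * D * (eta^-1 + 1))
               * (N d)%:R `^ (2 * alpha * eta))]).
Proof.
move=> alpha_gt g0 gS gamma_gt0 delta01 eta01.
have gamma_le1 j : gamma j <= 1.
  by elim: j => // j IH; exact: le_trans (gS j) IH.
have /andP[eta0 eta1] := eta01; have /andP[d0 d1] := delta01.
pose K : R := 1026 * 128 `^ (2 * alpha).
have K0 : 0 <= K by apply: mulr_ge0; [exact: ler0n|exact: powR_ge0].
have lnd0 : 0 <= ln delta^-1 by rewrite ln_ge0// invf_ge1// ltW.
pose c2 : R := 3 + 2 * ln delta^-1.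
have c20 : 0 < c2 by rewrite /c2; lra.
(* Both analytic conditions hold once ln (N - 1) is large; the first lets [C_N] absorb [K], the
   second is for d = 1. *)
have large (n0 : nat) : exists N : nat, [/\ prime N, (n0 <= N)%N, (1024 < N)%N,
    K <= ln (N%:R - 1) & 6 * expR (2 / eta) <= eta * ln N%:R].
  pose L : R := K + 6 * expR (2 / eta) / eta.
  have L1 : 0 <= 6 * expR (2 / eta) / eta by rewrite divr_ge0 ?mulr_ge0 ?expR_ge0// ltW.
  have [N hN pN] := prime_above (n0 + 1024 + (Num.truncn (expR L)).+1)%N.
  exists N; have eN : expR L <= N%:R - 1.
    rewrite lerBrDr; apply: le_trans (_ : (Num.truncn (expR L)).+1%:R + 1 <= _).
      by rewrite lerD2r ltW// truncnS_gt.
    by rewrite natr1 ler_nat; exact: leq_ltn_trans (leq_addl _ _) hN.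
  have n10 : 0 < N%:R - 1 :> R by apply: lt_le_trans eN; exact: expR_gt0.
  have LN : L <= ln (N%:R - 1) by rewrite -[leLHS]expRK ler_ln ?posrE ?expR_gt0.
  split=> //.
  - exact: ltnW (leq_ltn_trans (leq_trans (leq_addr _ _) (leq_addr _ _)) hN).
  - exact: leq_ltn_trans (leq_trans (leq_addl _ _) (leq_addr _ _)) hN.
  - by apply: le_trans LN; rewrite lerDl.
  rewrite -ler_pdivrMl// mulrC; apply: le_trans (_ : ln (N%:R - 1) <= _).
    by apply: le_trans LN; rewrite lerDr.
  by rewrite ler_ln ?posrE; lra.
have step (N n d : nat) (f : d.-tuple R -> R[i]) (t Y X : R) : prime N ->
    (1024 < N)%N -> K <= ln (N%:R - 1) -> (0 < d)%N -> 0 <= t ->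
    n.*2.+1%:R <= repetition_bound delta N ->
    (N.-1)%:R * 16^-1 ^+ n.+1 <= delta ->
    0 <= Y -> X = Y `^ (2 * alpha) ->
    expR (eta / G_sum alpha gamma d)^-1 * P_N alpha gamma d N (eta / G_sum alpha gamma d)
      <= Y * N%:R `^ eta ->
    korobov_space alpha gamma f ->
    error_bound_whp alpha gamma N n.*2.+1 (eta / G_sum alpha gamma d) delta f
      (korobov_norm alpha gamma f ^+ 2
       * (C_N alpha delta N t / (n.*2.+1 * N)%:R `^ (2 * alpha))
       * X * N%:R `^ (2 * alpha * eta)).
  move=> pN N1 KN dp t0 mQ hd Y0 XE hY fK.
  have tau0 : 0 < eta / G_sum alpha gamma d by rewrite divr_gt0// G_sum_gt0.
  apply: error_bound_whp_le (korobov_error_bound_whp alpha_gt gamma_gt0 gamma_le1 pN tau0 fK (ltW d0) hd).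
  exact: (rhs_ge alpha_gt eta01 (sqr_ge0 _) K0 t0 N1 (ltn0Sn _) mQ KN Y0 XE hY).
have G0 d : 0 <= G_sum alpha gamma d.
  by rewrite mulr_ge0// sumr_ge0// => j _; exact: powR_ge0.
have eta1_ge0 : 0 <= eta^-1 + 1 by rewrite addr_ge0// invr_ge0 ltW.
split.
(* The lower constant 1 is the bound ln N <= R of [repetitions_exist]; [c2] depends only on
   delta. *)
- move=> fin; exists 1, c2; split=> //; split=> // n0.
  have [N [pN n0N N1 KN _]] := large n0.
  have N_gt0 : (0 < N)%N := prime_gt0 pN.
  have [n [mQ lo hi hd]] := repetitions_exist delta01 N1.
  exists N, n.*2.+1; split=> //.
  + by rewrite /= odd_double.
  + by rewrite mul1r lo.
  move=> d f dp fK.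
  have GG := G_sum_le_infty d fin.
  apply: (step N n d f _ (expR ((eta^-1 + 1) * G_infty alpha gamma))) => //.
  + by rewrite mulr_ge0 ?invr_ge0 ?(ltW eta0)// (le_trans (G0 d)).
  + by rewrite -expRM; congr expR; ring.
  + apply: le_trans (expR_P_N_le _ gamma_gt0 eta01 dp N_gt0) _.
    by rewrite ler_wpM2r ?powR_ge0// ler_expR ler_wpM2l.
- move=> /G_sum_le_ln[D [D0 hD]].
  exists D, c2; split=> //; split=> // n0.
  have [N [pN n0N N1 KN big]] := large n0.
  have N_gt0 : (0 < N)%N := prime_gt0 pN.
  have [n [mQ lo hi hd]] := repetitions_exist delta01 N1.
  (* N and R are constant in d, so the polynomial bound b d^p holds with b = N and p = 0. *)
  exists N, 0%N, (fun=> N), (fun=> n.*2.+1) => d dp; split=> //.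
  + by rewrite n0N expn0 muln1 leqnn.
  + by rewrite /= odd_double.
  + by apply: le_trans hi _; rewrite ler_pM2l// lerDr ln_ge0// ler1n.
  move=> f fK.
  have t0 : 0 <= (G_sum alpha gamma d)^-1 * eta by rewrite mulr_ge0 ?invr_ge0// ltW.
  have XE : d%:R `^ (2 * alpha * D * (eta^-1 + 1))
     = (d%:R `^ (D * (eta^-1 + 1))) `^ (2 * alpha) by rewrite -powRrM; congr (_ `^ _); ring.
  apply: (step N n d f _ (d%:R `^ (D * (eta^-1 + 1)))) => //.
  (* For d = 1 the bound G <= D ln d would fail, since ln 1 = 0, and [expR_P_N_le1] takes over. *)
  have [d1'|dle] := ltnP 1 d.
    apply: le_trans (expR_P_N_le _ gamma_gt0 eta01 dp N_gt0) _.
    rewrite ler_wpM2r ?powR_ge0// /powR gt_eqF ?ltr0n// ler_expR.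
    by rewrite mulrAC mulrC ler_wpM2r//; exact: hD.
  have {dle} dE : d = 1%N by apply/eqP; rewrite eqn_leq dle.
  subst d; rewrite powR1 mul1r.
  exact: (expR_P_N_le1 alpha_gt gamma_gt0 gamma_le1 eta01 (prime_gt1 pN) big).
Qed.
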